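(* Let $p$ be an odd prime. Then the Laurent series $\Theta_p(t)\in\mathbb{F}_p(\!(t^{-1})\!)$ exhibits exactly $\frac{2}{p}$ escape of mass with respect to the sequence $\{t^k\}_{k\ge 0}$.
   Context: The $p$-Cantor sequence: let $p$ be an odd prime, $p_2=\frac{p-1}{2}$, and identify the alphabet $\{0,1,\dots,p-1\}$ with $\mathbb{F}_p$. Define the substitution $\phi_p$ sending each letter $n\in\mathbb{F}_p$ to the word $\phi_p(n)=\phi_p(n)_0\phi_p(n)_1\cdots\phi_p(n)_{p-1}$ of length $p$, where $\phi_p(n)_i=n\cdot\binom{p_2}{i/2}\bmod p$ if $i$ is even and $\phi_p(n)_i=0$ if $i$ is odd; $\phi_p$ acts on words by concatenating images of letters. The $p$-Cantor sequence $(c^{(p)}_i)_{i\ge0}$ over $\mathbb{F}_p$ is $\lim_{n\to\infty}\phi_p^n(1)$, and $\Theta_p(t):=t^{-1}\sum_{i=0}^\infty c^{(p)}_i t^{-i}$. Escape of mass: for a quadratic irrational $\Theta\in\mathbb{F}_q(\!(t^{-1})\!)$ and an irreducible $P\in\mathbb{F}_q[t]$, each $\Theta\cdot P^k$ is a quadratic irrational, so its continued fraction expansion (with polynomial partial quotients of degree $\ge1$ after the zeroth) is eventually periodic; let $\ell_{\Theta P^k}$ be the length of the period and $A_1^{[\Theta P^k]},\dots,A_{\ell_{\Theta P^k}}^{[\Theta P^k]}$ the partial quotients of one period. Set $R_{k,n}=\frac{\sum_{i=1}^{\ell_{\Theta P^k}}\max\{\deg A_i^{[\Theta P^k]}-n,0\}}{\sum_{i=1}^{\ell_{\Theta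 P^k}}\deg A_i^{[\Theta P^k]}}$. For $0<c\le1$, $\Theta$ exhibits $c$ escape of mass with respect to $\{P^k\}_{k\ge0}$ if $\lim_{n\to\infty}\liminf_{k\to\infty}R_{k,n}\ge c$; it exhibits exactly $c$ escape of mass if $c$ is the maximal such value. *)

(* Defs.v *)
From HB Require Import structures.
From mathcomp Require Import all_boot all_order all_algebra.
From mathcomp Require Import all_classical all_reals all_analysis.
Set Implicit Arguments. Unset Strict Implicit. Unset Printing Implicit Defensive.
Import Order.TTheory GRing.Theory Num.Theory.
Local Open Scope ring_scope.

(* A value  LSer e a  denotes  sum_{i >= 0} a i * t^(e - i)  in F((t^{-1})). *)
(* The representation is not unique; equality of series is [lser_eq].       *)
Section Laurent.
Variable F : fieldType.

Record lser := LSer { lexp : int ; lcf : nat -> F }.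

Definition lcoef (x : lser) (n : int) : F :=
  if n <= lexp x then lcf x (absz (lexp x - n)) else 0.

Definition lser_eq (x y : lser) : Prop := forall n : int, lcoef x n = lcoef y n.

Definition lzero : lser := LSer 0 (fun _ => 0).
Definition lone : lser := LSer 0 (fun i => (i == 0)%:R).

Definition ladd (x y : lser) : lser :=
  let e := Num.max (lexp x) (lexp y) in
  LSer e (fun i => lcoef x (e - i%:Z) + lcoef y (e - i%:Z)).

Definition lmul (x y : lser) : lser :=
  LSer (lexp x + lexp y) (fun n => \sum_(i < n.+1) lcf x i * lcf y (n - i)).

Definition lser_of_poly (q : {poly F}) : lser :=
  LSer (size q)%:Z (fun i => if (i <= size q)%N then q`_(size q - i) else 0).

Definition lpolypart (x : lser) : {poly F} :=
  \poly_(j < absz (lexp x + 1)) lcoef x j%:Z.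
Definition lfrac (x : lser) : lser :=
  LSer (-1) (fun i => lcoef x (- 1 - i%:Z)).

Definition lirrational (x : lser) : Prop :=
  forall q r : {poly F}, q != 0 ->
    ~ lser_eq (lmul (lser_of_poly q) x) (lser_of_poly r).

Definition quadratic_irrational (x : lser) : Prop :=
  lirrational x /\
  exists a b c : {poly F}, [|| a != 0, b != 0 | c != 0] /\
    lser_eq (ladd (lmul (lser_of_poly a) (lmul x x))
                  (ladd (lmul (lser_of_poly b) x) (lser_of_poly c))) lzero.

Definition is_cf_expansion (x : lser) (A : nat -> {poly F}) : Prop :=
  exists X : nat -> lser,
    lser_eq (X 0%N) x /\
    (forall i, A i = lpolypart (X i)) /\
    (forall i, lser_eq (lmul (X i.+1) (lfrac (X i))) lone).

Definition periodic_from (A : nat -> {poly F}) (N l : nat) : Prop :=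
  (0 < l)%N /\ forall i, (N <= i)%N -> A (i + l)%N = A i.

Definition cf_period_data (x : lser) (A : nat -> {poly F}) (N l : nat) : Prop :=
  is_cf_expansion x A /\ periodic_from A N l /\
  (forall N' l', periodic_from A N' l' -> (l <= l')%N).

Definition pdeg (q : {poly F}) : nat := (size q).-1.

Definition period_ratio {R : realType} (A : nat -> {poly F}) (N l n : nat) : R :=
  (\sum_(N <= i < N + l) (pdeg (A i) - n)%N)%:R /
  (\sum_(N <= i < N + l) pdeg (A i))%:R.

(* R_{k,n} for the series x (= Theta * P^k); the value is uniquely determined
   when x is a quadratic irrational. *)
Definition escape_ratio {R : realType} (x : lser) (n : nat) : R :=
  xget 0 [set r : R | exists A N l, cf_period_data x A N l /\
                                   r = period_ratio A N l n].

Definition Rkn {R : realType} (Theta : lser) (P : {poly F}) (k n : nat) : R :=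
  escape_ratio (lmul Theta (lser_of_poly (P ^+ k))) n.

Definition escape_of_mass {R : realType} (Theta : lser) (P : {poly F}) (c : R)
  : Prop :=
  [/\ quadratic_irrational Theta, irreducible_poly P, 0 < c, c <= 1 &
   (c%:E <= limn (fun n => limn_einf (fun k => (@Rkn R Theta P k n)%:E)))%E].

Definition exact_escape_of_mass {R : realType} (Theta : lser) (P : {poly F})
  (c : R) : Prop :=
  escape_of_mass Theta P c /\
  forall c' : R, escape_of_mass Theta P c' -> c' <= c.

End Laurent.

Section Cantor.
Variable p : nat.

Definition phi_letter (n : 'F_p) : seq 'F_p :=
  [seq (if odd i then 0 else n * ('C((p.-1)./2, i./2))%:R) | i <- iota 0 p].

Definition phi_word (w : seq 'F_p) : seq 'F_p := flatten (map phi_letter w).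

(* c_i = lim_n phi_p^n(1) at position i; the prefix of phi_p^n(1) is stable
   and phi_p^(i+1)(1) already has length p^(i+1) > i. *)
Definition cantor_seq (i : nat) : 'F_p := nth 0 (iter i.+1 phi_word [:: 1]) i.

Definition Theta_p : lser 'F_p := LSer (-1) cantor_seq.

End Cantor.

(* Main.v *)
(* Over F_p one has C(z) = (1 + z^2)^((p-1)/2) C(z)^p for the Cantor series C, so that
   Theta_p = 1 / sqrt D with D = t^2 + 1.  For alpha = t^k / sqrt D, a coprime pair P, Q with Q alpha close
   to P is a convergent followed by a partial quotient of degree k + 1 - deg N, where
   N = D P^2 - t^(2k) Q^2; large partial quotients are thus solutions of a norm equation with small N.

   Let p^s < k <= p^(s+1).  Powers m = p^v r of the unit t + sqrt D give, by the Frobenius, such pairs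
   with Q of degree about m: those with v = s + 1 give partial quotients of degree about k, and those with
   v = s of degree about 2 p^s - k.  Per stretch 2 p^(s+1) of degrees of Q this amounts to a total of at
   least about 4 p^s, which is the proportion 2 / p.

   For k = 2 p^s nothing else escapes: as t^k has derivative 0, a pair (P, Q) with deg N < k satisfies
   D (P' Q - P Q') + t P Q = 0 exactly, which makes P and Q essentially p-th powers of a pair of the same
   kind for k / p.  Descending to k = 2, parity under t -> -t leaves only units, whose exponent is
   divisible by p.  So partial quotients of degree at least 2 come from v = s + 1 only. *)

(* Why k = 2 p^s is extremal: among p consecutive multiples m of p^s, one is divisible by p^(s+1)
   and contributes about k, while each of the other p - 1 contributes about max(2 p^s - k, 0). The
   total falls until k = 2 p^s, where the second kind disappears, and rises afterwards; its minimum
   2 p^s, over a stretch p^(s+1) of degrees, is the proportion 2 / p. No period is ever computed.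
   The degrees d_i of the denominators of the convergents are compared with the sum of large gaps
   over long prefixes, up to a constant, and periodicity transfers the inequality to one period. In
   the counting, different exponents m must not claim the same partial quotient: a gap from d_i to
   d_(i+1) is therefore recorded by its centre, which determines m. Truncating at n costs at most n
   + 1 per exponent, hence (n + 1) p per stretch p^(s+1), which is negligible for fixed n as k
   grows. *)
Require Import Defs.
From HB Require Import structures.
From mathcomp Require Import all_boot all_order all_algebra.
From mathcomp Require Import all_classical all_reals all_analysis.
From mathcomp Require Import finfield ring zify.
Set Implicit Arguments. Unset Strict Implicit. Unset Printing Implicit Defensive.
Import Order.TTheory GRing.Theory Num.Theory.
Local Open Scope ring_scope.

(** * Formal power series *)

Section PowerSeries.
Variable F : fieldType.
Implicit Types (p q : {poly F}).

(** A record of its own, so that the product can be the Cauchy product instead of the pointwise one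
    on functions. *)
Record pseries := PSeries { psc : nat -> F }.

HB.instance Definition _ := gen_eqMixin pseries.
HB.instance Definition _ := gen_choiceMixin pseries.

Lemma psP (a b : pseries) : psc a =1 psc b -> a = b.
Proof. by case: a b => [a] [b] /= /funext ->. Qed.

Definition ps_add (a b : pseries) := PSeries (fun n => psc a n + psc b n).
Definition ps_opp (a : pseries) := PSeries (fun n => - psc a n).
Definition ps_zero := PSeries (fun _ => 0).
Definition ps_mul (a b : pseries) :=
  PSeries (fun n => \sum_(i < n.+1) psc a i * psc b (n - i)).
Definition ps_of_poly (q : {poly F}) := PSeries (fun n => q`_n).

Lemma ps_addA : associative ps_add.
Proof. by move=> a b c; apply: psP => n /=; rewrite addrA. Qed.
Lemma ps_addC : commutative ps_add.
Proof. by move=> a b; apply: psP => n /=; rewrite addrC. Qed.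
Lemma ps_add0 : left_id ps_zero ps_add.
Proof. by move=> a; apply: psP => n /=; rewrite add0r. Qed.
Lemma ps_addN : left_inverse ps_zero ps_opp ps_add.
Proof. by move=> a; apply: psP => n /=; rewrite addNr. Qed.

HB.instance Definition _ :=
  GRing.isZmodule.Build pseries ps_addA ps_addC ps_add0 ps_addN.

Definition ps_trunc N (a : pseries) : {poly F} := \poly_(i < N) psc a i.

Lemma coef_trunc N a n : (n < N)%N -> (ps_trunc N a)`_n = psc a n.
Proof. by rewrite coef_poly => ->. Qed.

Lemma coef_mul_congr p p' q q' n :
  (forall i, (i <= n)%N -> p`_i = p'`_i) ->
  (forall i, (i <= n)%N -> q`_i = q'`_i) -> (p * q)`_n = (p' * q')`_n.
Proof.
move=> hp hq; rewrite !coefM; apply: eq_bigr => i _.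
by rewrite hp ?hq ?leq_subr // -ltnS.
Qed.

(** Each coefficient of a product sees only finitely many others, so the ring axioms are inherited
    from polynomials. *)
Lemma ps_mul_trunc N a b n : (n < N)%N ->
  psc (ps_mul a b) n = (ps_trunc N a * ps_trunc N b)`_n.
Proof.
move=> ltnN; rewrite coefM /=; apply: eq_bigr => i _.
by rewrite !coef_trunc //; apply: leq_ltn_trans ltnN; rewrite ?leq_subr // -ltnS.
Qed.

Lemma ps_mulA : associative ps_mul.
Proof.
move=> a b c; apply: psP => n; rewrite !(ps_mul_trunc _ _ (ltnSn n)).
have tr x y i : (i <= n)%N -> (ps_trunc n.+1 (ps_mul x y))`_i
    = (ps_trunc n.+1 x * ps_trunc n.+1 y)`_i.
  by move=> lein; rewrite coef_trunc ?ltnS // (@ps_mul_trunc n.+1).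
rewrite (coef_mul_congr (p' := ps_trunc n.+1 a) _ (tr b c)) // mulrA.
by apply: coef_mul_congr => // i lein; rewrite tr.
Qed.

Lemma ps_mulC : commutative ps_mul.
Proof.
by move=> a b; apply: psP => n; rewrite !(ps_mul_trunc _ _ (ltnSn n)) mulrC.
Qed.

Lemma ps_mul1 : left_id (ps_of_poly 1) ps_mul.
Proof.
move=> a; apply: psP => n /=; rewrite big_ord_recl /= coef1 mul1r subn0.
by rewrite big1 ?addr0 // => i _; rewrite coef1 mul0r.
Qed.

Lemma ps_mulDl : left_distributive ps_mul ps_add.
Proof.
move=> a b c; apply: psP => n /=; rewrite -big_split /=.
by apply: eq_bigr => i _; rewrite mulrDl.
Qed.

Lemma ps_one_neq0 : ps_of_poly 1 != ps_zero.
Proof.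
apply/eqP => /(congr1 (fun a => psc a 0)) /= /eqP.
by rewrite coef1 oner_eq0.
Qed.

HB.instance Definition _ := GRing.Zmodule_isComNzRing.Build pseries
  ps_mulA ps_mulC ps_mul1 ps_mulDl ps_one_neq0.

Lemma pscD a b n : psc (a + b) n = psc a n + psc b n. Proof. by []. Qed.
Lemma pscN a n : psc (- a) n = - psc a n. Proof. by []. Qed.
Lemma pscM a b n : psc (a * b) n = \sum_(i < n.+1) psc a i * psc b (n - i).
Proof. by []. Qed.
Lemma psc1 n : psc 1 n = (n == 0)%:R. Proof. by rewrite /= coef1. Qed.
Lemma psc_sum (I : Type) (r : seq I) (P : pred I) (G : I -> pseries) n :
  psc (\sum_(i <- r | P i) G i) n = \sum_(i <- r | P i) psc (G i) n.
Proof. by elim/big_rec2: _ => // i x y _ <-. Qed.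
Lemma pscM0 a b : psc (a * b) 0 = psc a 0 * psc b 0.
Proof. by rewrite pscM big_ord1. Qed.
Lemma pscX0 a n : psc (a ^+ n) 0 = psc a 0 ^+ n.
Proof. by elim: n => [|n IH]; rewrite ?expr0 ?psc1 // !exprS pscM0 IH. Qed.

Lemma ps_of_polyM p q : ps_of_poly (p * q) = ps_of_poly p * ps_of_poly q.
Proof. by apply: psP => n; rewrite pscM /= coefM. Qed.

Definition psX : pseries := ps_of_poly 'X.

Lemma psc_XnM m a n :
  psc (psX ^+ m * a) n = if (n < m)%N then 0 else psc a (n - m).
Proof.
have -> : psX ^+ m = ps_of_poly 'X^m.
  by elim: m => // m IH; rewrite !exprS IH ps_of_polyM.
case: ltnP => [ltnm | lemn].
  rewrite pscM big1 // => i _ /=; rewrite coefXn.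
  by rewrite ltn_eqF ?mul0r // (leq_ltn_trans _ ltnm) // -ltnS.
rewrite pscM (bigD1 (inord m)) //= inordK ?ltnS // coefXn eqxx mul1r big1 ?addr0 //.
move=> i /eqP ne; rewrite coefXn; case: eqP => [eim|]; last by rewrite mul0r.
by case: ne; apply: val_inj; rewrite /= inordK ?ltnS.
Qed.

Lemma psX_neq0 : psX != 0.
Proof.
by apply/eqP => /(congr1 (fun a => psc a 1)) /=; rewrite coefX /= => /eqP; rewrite oner_eq0.
Qed.

Lemma ps_normal a : a != 0 -> exists2 m, exists u, a = psX ^+ m * u & psc a m != 0.
Proof.
move=> a0; have ex : exists m, psc a m != 0.
  apply/not_existsP => h; case/eqP: a0; apply: psP => n.
  by apply/eqP/negPn/negP; apply: h.
have [m hm min] := ex_minnP ex; exists m => //.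
exists (PSeries (fun n => psc a (n + m))); apply: psP => n; rewrite psc_XnM.
case: ltnP => [ltnm|lemn] /=; last by rewrite subnK.
by apply/eqP/negPn/negP => /min; rewrite leqNgt ltnm.
Qed.

Lemma psc_mul_eq0_lt (y : pseries) n m : psc y 0 = 0 -> (m < n)%N -> psc (y ^+ n) m = 0.
Proof.
move=> y0; have -> : y = psX * PSeries (fun i => psc y i.+1).
  apply: psP => i; have := psc_XnM 1 (PSeries (fun i => psc y i.+1)) i.
  by rewrite expr1 => ->; case: i => //= i; rewrite subn1.
by move=> ltmn; rewrite exprMn psc_XnM ltmn.
Qed.

(* Geometric series in 1 - a / a_0. *)
Lemma ps_inv_exists a : psc a 0 != 0 -> exists b, b * a = 1.
Proof.
move=> a0; pose c := ps_of_poly (psc a 0)^-1%:P.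
pose y := 1 - c * a.
have y0 : psc y 0 = 0 by rewrite pscD pscN psc1 pscM0 /= coefC mulVf ?subrr.
pose g := PSeries (fun n => psc (\sum_(i < n.+1) y ^+ i) n).
(* As y has no constant term, y^i does not reach coefficient n when i > n, and the partial sums
   stabilise there. *)
have gE n N : (n < N)%N -> psc g n = psc (\sum_(i < N) y ^+ i) n.
  move=> ltnN; rewrite /g /= !psc_sum (big_ord_widen N (fun i => psc (y ^+ i) n)) //.
  rewrite big_mkcond; apply: eq_bigr => i _; case: ltnP => // lt.
  by rewrite psc_mul_eq0_lt.
suff g1 : g * (1 - y) = 1.
  by exists (g * c); rewrite -mulrA; move: g1; rewrite /y opprB addrC subrK.
apply: psP => n; transitivity (psc ((\sum_(i < n.+1) y ^+ i) * (1 - y)) n).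
  by rewrite !pscM; apply: eq_bigr => i _; rewrite (gE i n.+1).
have geom (x : pseries) : (\sum_(i < n.+1) x ^+ i) * (1 - x) = 1 - x ^+ n.+1.
  by rewrite mulrC -(opprB x) mulNr -subrX1 opprB.
by rewrite geom pscD pscN psc_mul_eq0_lt // subr0.
Qed.

Definition ps_unit : {pred pseries} := fun a => psc a 0 != 0.
Definition ps_inv (a : pseries) : pseries :=
  if pselect (exists b, b * a = 1) is left h then projT1 (cid h) else a.

Lemma ps_mulVx : {in ps_unit, left_inverse 1 ps_inv *%R}.
Proof.
move=> a a0; rewrite /ps_inv; case: pselect => [h|]; first exact: (projT2 (cid h)).
by case; apply: ps_inv_exists.
Qed.

Lemma ps_unitPl (a b : pseries) : b * a = 1 -> ps_unit a.
Proof.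
move=> /(congr1 (fun x => psc x 0)); rewrite pscM0 psc1 eqxx => h; apply/eqP => a0.
by move/eqP: h; rewrite a0 mulr0 eq_sym oner_eq0.
Qed.

Lemma ps_inv_out : {in [predC ps_unit], ps_inv =1 id}.
Proof.
move=> a /negP a0; rewrite /ps_inv; case: pselect => // h; case: a0.
by case: h => b /ps_unitPl.
Qed.

HB.instance Definition _ := GRing.ComNzRing_hasMulInverse.Build pseries
  ps_mulVx ps_unitPl ps_inv_out.

(** The lowest nonzero coefficients multiply to a nonzero one. *)
Lemma ps_integral (a b : pseries) : a * b = 0 -> (a == 0) || (b == 0).
Proof.
move=> ab0; apply/norP => -[/ps_normal[i [u au] ai] /ps_normal[j [v bv] bj]].
move: ab0; rewrite au bv mulrACA -exprD => /(congr1 (fun x => psc x (i + j))).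
rewrite psc_XnM ltnn subnn pscM0 => /eqP; rewrite mulf_eq0.
move: ai bj; rewrite au bv !psc_XnM !ltnn !subnn.
by move=> /negPf -> /negPf ->.
Qed.

HB.instance Definition _ := GRing.ComUnitRing_isIntegral.Build pseries ps_integral.

End PowerSeries.

(** * Laurent series as fractions of power series *)

Section LaurentField.
Variable F : fieldType.
Implicit Types (q r : {poly F}) (a b : pseries F) (x y : {fraction pseries F}).

Local Notation K := {fraction (pseries F)}.
Local Notation tofr := (@FracField.tofrac (pseries F)).

(** The fraction field of F[[X]] serves as F((t^-1)), with t = 1/X. *)
Definition tL : K := (tofr (psX F))^-1.

Lemma tL_neq0 : tL != 0.
Proof. by rewrite invr_eq0 tofrac_eq0 psX_neq0. Qed.

Lemma tLX_psX n : tL ^+ n * tofr (psX F ^+ n) = 1.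
Proof. by rewrite tofracXn exprVn mulVf // expf_neq0 // tofrac_eq0 psX_neq0. Qed.

(* [lc x e c]: the expansion of x has no term above t^e, and c is its coefficient at t^e. *)
Definition lc x (e : int) (c : F) := exists2 a, x = tL ^ e * tofr a & psc a 0 = c.

Lemma lcD x y e c d : lc x e c -> lc y e d -> lc (x + y) e (c + d).
Proof. by move=> [a -> <-] [b -> <-]; exists (a + b) => //; rewrite tofracD mulrDr. Qed.

Lemma lcN x e c : lc x e c -> lc (- x) e (- c).
Proof. by move=> [a -> <-]; exists (- a) => //; rewrite tofracN mulrN. Qed.

Lemma lcM x y e f c d : lc x e c -> lc y f d -> lc (x * y) (e + f) (c * d).
Proof.
move=> [a -> <-] [b -> <-]; exists (a * b); last by rewrite pscM0.
by rewrite tofracM mulrACA -expfzDr // tL_neq0.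
Qed.

Lemma lc0 e : lc 0 e 0.
Proof. by exists 0 => //; rewrite tofrac0 mulr0. Qed.

Lemma lc1 : lc 1 0 1.
Proof. by exists 1; rewrite ?psc1 // tofrac1 mulr1 expr0z. Qed.

Lemma lc_tL : lc tL 1 1.
Proof. by exists 1; rewrite ?psc1 // tofrac1 mulr1 expr1z. Qed.

Lemma lc_lift x e f c : e < f -> lc x e c -> lc x f 0.
Proof.
move=> ltef [a -> _]; pose m := `|(f - e)%R|%N.
have fE : f = e + m.+1.-1%:Z by rewrite /m; lia.
have m0 : (0 < m)%N by rewrite /m; lia.
exists (psX F ^+ m * a); last by rewrite psc_XnM m0.
rewrite fE expfzDr ?tL_neq0 // tofracM -mulrA; congr (_ * _).
by rewrite mulrA -exprnP /= tLX_psX mul1r.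
Qed.

Lemma lc_coef_uniq x e c d : lc x e c -> lc x e d -> c = d.
Proof.
move=> [a -> <-] [b /(mulfI (expfz_neq0 _ tL_neq0)) /eqP].
by rewrite tofrac_eq => /eqP -> <-.
Qed.

Lemma lc_le x e f c d : c != 0 -> lc x e c -> lc x f d -> e <= f.
Proof.
move=> c0 xe xf; rewrite leNgt; apply/negP => /lc_lift/(_ xf)/lc_coef_uniq/(_ xe) h.
by rewrite -h eqxx in c0.
Qed.

Lemma lc_uniq x e f c d : c != 0 -> d != 0 -> lc x e c -> lc x f d -> e = f.
Proof.
move=> c0 d0 xe xf; apply/eqP.
by rewrite eq_le (lc_le c0 xe xf) (lc_le d0 xf xe).
Qed.

Lemma lc_neq0 x e c : c != 0 -> lc x e c -> x != 0.
Proof.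
by move=> c0 xe; apply: contraNneq c0 => x0; rewrite x0 in xe; rewrite -(lc_coef_uniq (lc0 e) xe).
Qed.

Lemma lcV x e c : c != 0 -> lc x e c -> lc x^-1 (- e) c^-1.
Proof.
move=> c0 [a -> a0]; have ua : a \is a GRing.unit by rewrite /in_mem /= /ps_unit a0.
have aV0 : psc a^-1 0 * c = 1 by rewrite -a0 -pscM0 mulVr // psc1.
exists a^-1; last by rewrite -[LHS](mulfK c0) aV0 mul1r.
have x0 : tL ^ e * tofr a != 0.
  rewrite mulf_neq0 ?expfz_neq0 ?tL_neq0 // tofrac_eq0.
  by apply: contraNneq c0 => a00; rewrite -a0 a00.
apply: (mulfI x0); rewrite divff //.
by rewrite mulrACA -expfzDr ?tL_neq0 // subrr mul1r -tofracM divrr ?tofrac1.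
Qed.

Definition cst (c : F) : K := tofr (ps_of_poly c%:P).

Lemma cst_zmod : zmod_morphism cst.
Proof.
move=> c d; rewrite /cst -tofracB; congr tofr; apply: psP => n.
by rewrite pscD pscN /= polyCB coefB.
Qed.

Lemma cst_monoid : monoid_morphism cst.
Proof.
split=> [|c d]; first by rewrite /cst -tofrac1.
by rewrite /cst -tofracM polyCM ps_of_polyM.
Qed.

HB.instance Definition _ := GRing.isZmodMorphism.Build F K cst cst_zmod.
HB.instance Definition _ := GRing.isMonoidMorphism.Build F K cst cst_monoid.

Lemma lc_cst c : lc (cst c) 0 c.
Proof. by exists (ps_of_poly c%:P); rewrite /= ?coefC // expr0z mul1r. Qed.

Definition embed : {poly F} -> K := horner_eval tL \o map_poly cst.

HB.instance Definition _ := GRing.RMorphism.copy embed (horner_eval tL \o map_poly cst).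

Lemma embedC c : embed c%:P = cst c.
Proof. by rewrite /embed /= /horner_eval map_polyC hornerC. Qed.
Lemma embedX : embed 'X = tL.
Proof. by rewrite /embed /= /horner_eval map_polyX hornerX. Qed.

Lemma lc_embed_coef q n : (size q <= n.+1)%N -> lc (embed q) n%:Z q`_n.
Proof.
elim/poly_ind: q n => [|r c IH] n; first by rewrite rmorph0 coef0 => _; exact: lc0.
rewrite rmorphD rmorphM /= embedX embedC => sz.
have szr : (size r <= n)%N.
  move: sz; rewrite size_MXaddC; case: ifP => [/andP[/eqP -> _]|_]; last by rewrite ltnS.
  by rewrite size_poly0.
case: n szr sz => [|n] szr _.
  move: szr; rewrite leqn0 size_poly_eq0 => /eqP ->.
  by rewrite rmorph0 !mul0r !add0r coefC; exact: lc_cst.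
rewrite coefD coefMX coefC /= addr0 -[r`_n]addr0; apply: lcD.
  have -> : n.+1%:Z = n%:Z + 1 by rewrite -addn1.
  by rewrite -[r`_n]mulr1; apply: lcM lc_tL; apply: IH.
by apply: lc_lift (lc_cst c).
Qed.

Lemma lc_embed q : lc (embed q) ((size q)%:Z - 1) (lead_coef q).
Proof.
have [->|q0] := eqVneq q 0; first by rewrite rmorph0 lead_coef0; exact: lc0.
have := @lc_embed_coef q (size q).-1; rewrite leqSpred lead_coefE => /(_ isT).
by rewrite predn_int // size_poly_gt0.
Qed.

Lemma embed_inj : injective embed.
Proof.
move=> q r /eqP; rewrite -subr_eq0 -rmorphB /= => h; apply/eqP; rewrite -subr_eq0.
apply: contraLR h; rewrite -lead_coef_eq0 => h.
exact: lc_neq0 h (lc_embed _).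
Qed.

Lemma embed_eq0 q : (embed q == 0) = (q == 0).
Proof. by rewrite -(rmorph0 embed) (inj_eq embed_inj). Qed.

Lemma lc_embed_size q e c : c != 0 -> lc (embed q) e c -> (size q)%:Z = e + 1.
Proof.
move=> c0 h; have q0 : q != 0 by rewrite -embed_eq0; exact: lc_neq0 h.
by rewrite -(lc_uniq _ c0 (lc_embed q) h) ?lead_coef_eq0 // subrK.
Qed.

(** The integrality principle behind uniqueness of good approximations: a polynomial that is too
    small must vanish. *)
Lemma lc_embed_neg q e c : e < 0 -> lc (embed q) e c -> q = 0.
Proof.
move=> e0 h; apply/eqP; apply: contraTT e0 => q0.
have := lc_le _ (lc_embed q) h; rewrite lead_coef_eq0 => /(_ q0).
by move: q0; rewrite -size_poly_gt0; lia.
Qed.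

(** Forgets the choice of representation: [lser_eq] becomes equality in a field, where algebra is
    available. *)
Definition phi (x : lser F) : K := tL ^ (lexp x) * tofr (PSeries (lcf x)).

Lemma phiE (x : lser F) e : lexp x <= e ->
  phi x = tL ^ e * tofr (PSeries (fun i => lcoef x (e - i%:Z))).
Proof.
move=> le; pose m := `|(e - lexp x)%R|%N.
have eE : e = lexp x + m%:Z by rewrite /m; lia.
have -> : PSeries (fun i => lcoef x (e - i%:Z)) = psX F ^+ m * PSeries (lcf x).
  apply: psP => i; rewrite psc_XnM /= /lcoef; case: ltnP => hi.
    by case: ifP => //; lia.
  by case: ifP => [_|]; [congr lcf; lia | lia].
rewrite eE expfzDr ?tL_neq0 // tofracM -mulrA; congr (_ * _).
by rewrite mulrA -exprnP tLX_psX mul1r.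
Qed.

Lemma lser_eqP (x y : lser F) : lser_eq x y <-> phi x = phi y.
Proof.
have hx : lexp x <= Num.max (lexp x) (lexp y) by rewrite le_max lexx.
have hy : lexp y <= Num.max (lexp x) (lexp y) by rewrite le_max lexx orbT.
rewrite (phiE hx) (phiE hy); set e := Num.max _ _; split=> [h|].
  by congr (_ * tofr _); apply: psP => i /=; rewrite h.
move=> /(mulfI (expfz_neq0 _ tL_neq0)) /eqP; rewrite tofrac_eq => /eqP [h] n.
have [len|ltn] := leP n e.
  have := congr1 (fun f => f `|(e - n)%R|%N) h => /=.
  by have -> : e - `|(e - n)%R|%:Z = n by lia.
by rewrite /lcoef; do 2 (case: ifP => ?; first by lia).
Qed.

Lemma lcoef_ladd (x y : lser F) n : lcoef (ladd x y) n = lcoef x n + lcoef y n.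
Proof.
rewrite {1}/lcoef /=; case: ifP => h.
  by have -> : Num.max (lexp x) (lexp y)
     - `|(Num.max (lexp x) (lexp y) - n)%R|%:Z = n by lia.
rewrite /lcoef; move: h; rewrite le_max => /negbT/norP[/negPf -> /negPf ->].
by rewrite addr0.
Qed.

Lemma phi_add (x y : lser F) : phi (ladd x y) = phi x + phi y.
Proof.
have hx : lexp x <= Num.max (lexp x) (lexp y) by rewrite le_max lexx.
have hy : lexp y <= Num.max (lexp x) (lexp y) by rewrite le_max lexx orbT.
rewrite (phiE hx) (phiE hy) -mulrDr -tofracD /phi; congr (_ * tofr _); exact: psP.
Qed.

Lemma phi_mul (x y : lser F) : phi (lmul x y) = phi x * phi y.
Proof.
rewrite /phi [RHS]mulrACA -expfzDr ?tL_neq0 // -tofracM; congr (_ * tofr _); exact: psP.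
Qed.

Lemma phi_zero : phi (lzero F) = 0.
Proof.
rewrite /phi; have -> : PSeries (lcf (lzero F)) = 0 by exact: psP.
by rewrite tofrac0 mulr0.
Qed.

Lemma phi_one : phi (lone F) = 1.
Proof.
rewrite /phi expr0z mul1r; have -> : PSeries (lcf (lone F)) = 1.
  by apply: psP => n; rewrite psc1.
by rewrite tofrac1.
Qed.

Lemma phi_poly q : phi (lser_of_poly q) = embed q.
Proof.
pose s := size q.
have -> : embed q = \sum_(i < s.+1) cst q`_i * tL ^+ i.
  rewrite /embed /= /horner_eval (@horner_coef_wide _ s.+1).
    by apply: eq_bigr => i _; rewrite coef_map.
  by rewrite (leq_trans (size_poly _ _)).
rewrite /phi /=.
have -> : PSeries (fun i => if (i <= size q)%N then q`_(size q - i) else 0)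
   = \sum_(i < s.+1) psX F ^+ i * ps_of_poly (q`_(s - i))%:P.
  apply: psP => n; rewrite psc_sum [LHS]/=; case: leqP => hn.
    rewrite (bigD1 (inord n)) // big1 => [|i /eqP ni].
      by rewrite [RHS]addr0 psc_XnM inordK ?ltnS // ltnn subnn /= coefC eqxx.
    rewrite psc_XnM; case: ltnP => // lein; rewrite /= coefC; case: eqP => // e0.
    by case: ni; apply: val_inj; rewrite /= inordK ?ltnS //; lia.
  rewrite big1 // => i _; rewrite psc_XnM; case: ltnP => // lein; rewrite /= coefC.
  by case: eqP => // e0; have := ltn_ord i; move: (nat_of_ord i) lein e0 hn; rewrite -/s; lia.
rewrite raddf_sum mulr_sumr (reindex_inj rev_ord_inj) /=; apply: eq_bigr => i _.
rewrite tofracM mulrA subSS; have lei : (i <= s)%N by rewrite -ltnS.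
have -> : tL ^ s * tofr (psX F ^+ (s - i)) = tL ^+ i.
  rewrite -{1}(subnK lei) PoszD expfzDr ?tL_neq0 // -!exprnP mulrAC.
  by rewrite tLX_psX mul1r.
by rewrite subKn // mulrC.
Qed.

Lemma coef_lpolypart (x : lser F) j : (lpolypart x)`_j = lcoef x j%:Z.
Proof.
rewrite coef_poly; case: ltnP => // h; rewrite /lcoef; case: ifP => //; lia.
Qed.

Lemma lcoef_poly q n : lcoef (lser_of_poly q) n = if 0 <= n then q`_`|n|%N else 0.
Proof.
rewrite /lcoef /=; case: ifP => h1; last first.
  by case: ifP => // h2; rewrite nth_default //; lia.
have [h3|h3] := leP 0 n; last by case: ifP => //; lia.
by case: ifP => h2; [congr (_`_ _); lia | lia].
Qed.

Lemma phi_split (x : lser F) : phi x = embed (lpolypart x) + phi (lfrac x).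
Proof.
rewrite -phi_poly -phi_add; apply/lser_eqP => n; rewrite lcoef_ladd lcoef_poly.
rewrite [lcoef (lfrac x) n]/lcoef /=; have [h|h] := leP n (-1).
  have -> : -1 - `|(-1 - n)%R|%:Z = n by lia.
  by case: ifP => h1; [lia | rewrite add0r].
rewrite addr0; case: ifP => h1; last lia.
by rewrite coef_lpolypart; congr lcoef; lia.
Qed.

Lemma lc_lfrac (x : lser F) : exists c, lc (phi (lfrac x)) (-1) c.
Proof. by eexists; exists (PSeries (lcf (lfrac x))). Qed.

Lemma phi_inv (x : lser F) : phi x != 0 -> exists y : lser F, phi y * phi x = 1.
Proof.
rewrite /phi mulf_eq0 negb_or tofrac_eq0 => /andP[_ /ps_normal[m [u xu]]].
rewrite xu psc_XnM ltnn subnn => u0.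
have uu : u \is a GRing.unit by [].
exists (LSer (m%:Z - lexp x) (psc u^-1)); rewrite /phi /=.
have -> : PSeries (psc u^-1) = u^-1 by exact: psP.
rewrite mulrACA -expfzDr ?tL_neq0 // subrK -tofracM mulrCA mulVr // mulr1.
by rewrite -exprnP tLX_psX.
Qed.

Lemma lpolypart_congr (x y : lser F) : phi x = phi y -> lpolypart x = lpolypart y.
Proof. by move=> /lser_eqP h; apply/polyP => j; rewrite !coef_lpolypart h. Qed.

Lemma phi_lfrac_congr (x y : lser F) : phi x = phi y -> phi (lfrac x) = phi (lfrac y).
Proof.
by move=> h; move: (h); rewrite (phi_split x) (phi_split y) (lpolypart_congr h) => /addrI.
Qed.

End LaurentField.

(** * The Cantor series *)

Section CantorSeries.
Variable p : nat.
Hypotheses (hp : prime p) (hodd : odd p).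

Let p_gt0 : (0 < p)%N := prime_gt0 hp.

Definition cantor_digit (j : nat) : 'F_p :=
  if odd j then 0 else ('C((p.-1)./2, j./2))%:R.

Lemma nth_phi_word (w : seq 'F_p) i :
  nth 0 (phi_word w) i = nth 0 w (i %/ p) * cantor_digit (i %% p).
Proof.
elim: w i => [|x w IH] i; first by rewrite !nth_nil mul0r.
rewrite /phi_word /= nth_cat size_map size_iota; case: ltnP => hi.
  rewrite (nth_map 0) ?size_iota // nth_iota // divn_small // modn_small //=.
  by rewrite /cantor_digit; case: ifP; rewrite ?mulr0.
rewrite -[flatten _]/(phi_word w) IH -{3 4}(subnK hi) divnDr ?dvdnn // divnn p_gt0.
by rewrite addn1 modnDr.
Qed.

Local Notation W m := (iter m (@phi_word p) [:: 1]).

(** The image of 1 begins with 1, so each iterate is a prefix of the next. *)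
Lemma nth_cantor_word m i : (i < p ^ m)%N -> nth 0 (W m.+1) i = nth 0 (W m) i.
Proof.
elim: m i => [|m IH] i hi.
  move: hi; rewrite expn0 ltnS leqn0 => /eqP ->.
  by rewrite iterS nth_phi_word div0n mod0n mul1r /cantor_digit /= bin0.
have E n : nth 0 (W n.+1) i = nth 0 (W n) (i %/ p) * cantor_digit (i %% p).
  exact: nth_phi_word.
rewrite (E m.+1) (E m) IH //.
by rewrite ltn_divLR // -expnSr.
Qed.

Lemma cantor_seq0 : cantor_seq p 0 = 1.
Proof. by rewrite /cantor_seq nth_cantor_word. Qed.

(** The limit word is fixed by the substitution, and letter i lies in the image of letter i / p, at
    place i mod p. *)
Lemma cantor_seq_rec i :
  cantor_seq p i = cantor_seq p (i %/ p) * cantor_digit (i %% p).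
Proof.
have stable m d j : (j < p ^ m)%N -> nth 0 (W (m + d)) j = nth 0 (W m) j.
  move=> hj; elim: d => [|d IH]; first by rewrite addn0.
  rewrite addnS nth_cantor_word // (leq_trans hj) // leq_exp2l ?leq_addr //.
  exact: prime_gt1.
rewrite {1}/cantor_seq iterS nth_phi_word; congr (_ * _).
case: i => [|i]; first by rewrite div0n cantor_seq0.
have lt : (i.+1 %/ p < i.+1)%N by rewrite ltn_Pdiv // prime_gt1.
rewrite /cantor_seq -{1}(subnKC lt) stable //.
by rewrite (ltn_trans (ltnSn _)) // ltn_expl // prime_gt1.
Qed.

Lemma coef_1X2_exp (R : comNzRingType) m n :
  (('X^2 + 1 : {poly R}) ^+ m)`_n = if odd n then 0 else 'C(m, n./2)%:R.
Proof.
elim: m n => [|m IH] n.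
  by rewrite expr0 coef1; case: n => [|[|n]] //=; rewrite bin0n; case: ifP.
rewrite exprSr mulrDr mulr1 coefD coefMXn !IH.
case: n => [|[|n]] /=; rewrite ?add0r ?bin0 // subn2 /= negbK.
by case: ifP => _; rewrite ?addr0 // binS natrD addrC.
Qed.

Lemma Fp_expp (c : 'F_p) : c ^+ p = c.
Proof. by have := expf_card c; rewrite card_Fp. Qed.

Lemma pchar_polyFp : p \in [pchar {poly 'F_p}].
Proof. by rewrite pchar_poly pchar_Fp. Qed.

Lemma poly_expp (q : {poly 'F_p}) : q ^+ p = q \Po 'X^p.
Proof.
elim/poly_ind: q => [|q c IH]; first by rewrite comp_poly0 expr0n -[p]prednK.
rewrite -[X in X = _](pFrobenius_autE pchar_polyFp) rmorphD rmorphM /=.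
rewrite !pFrobenius_autE IH comp_polyD comp_polyM comp_polyX comp_polyC.
by rewrite -polyC_exp Fp_expp.
Qed.

Lemma psc_exp_trunc (a : pseries 'F_p) N m n : (n < N)%N ->
  psc (a ^+ m) n = (ps_trunc N a ^+ m)`_n.
Proof.
elim: m n => [|m IH] n ltnN; first by rewrite !expr0 psc1 coef1.
rewrite !exprS (ps_mul_trunc _ _ ltnN); apply: coef_mul_congr => // i lein.
by rewrite coef_trunc ?IH //; apply: leq_ltn_trans ltnN.
Qed.

Definition cantor_ps := PSeries (cantor_seq p).

Lemma psc_cantor_expp n :
  psc (cantor_ps ^+ p) n = if (p %| n)%N then cantor_seq p (n %/ p) else 0.
Proof.
rewrite (psc_exp_trunc _ _ (ltnSn n)) poly_expp coef_comp_poly_Xn //.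
by case: ifP => // _; rewrite coef_trunc // ltnS leq_div.
Qed.

Local Notation D := ('X^2 + 1 : {poly 'F_p}).

Lemma cantor_ps_fixpoint :
  cantor_ps = ps_of_poly (D ^+ (p.-1)./2) * cantor_ps ^+ p.
Proof.
apply: psP => n; rewrite pscM [LHS]/= cantor_seq_rec.
have lt : (n %% p < n.+1)%N by rewrite ltnS leq_mod.
rewrite (bigD1 (Ordinal lt)) //= big1 => [|i /eqP ni].
  rewrite addr0 coef_1X2_exp psc_cantor_expp mulrC; congr (_ * _).
  have -> : (n - n %% p = n %/ p * p)%N by rewrite {1}(divn_eq n p) addnK.
  by rewrite dvdn_mull // mulnK.
(* Exponents in C^p are multiples of p and D^((p-1)/2) has degree p - 1, so only the index n mod p
   contributes to the convolution. *)
rewrite coef_1X2_exp psc_cantor_expp; case: ifP => oi; first by rewrite mul0r.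
have [ltip|leip] := ltnP i p; last first.
  rewrite bin_small ?mul0r //.
  move: leip oi hodd; rewrite leq_eqVlt => /orP[/eqP <-|]; first by move=> ->.
  lia.
case: ifP => [/dvdnP[j ej]|]; last by rewrite mulr0.
case: ni; apply: val_inj => /=.
have lein : (i <= n)%N by rewrite -ltnS.
by rewrite -[in RHS](subnK lein) ej modnMDl modn_small.
Qed.

(** Cancelling C in the fixed-point equation leaves y^h = 1 for h = (p - 1) / 2. If y were not 1,
    then 1 + y + ... + y^(h-1) would vanish, although its constant term is h, nonzero mod p. *)
Lemma cantor_ps_sqr : ps_of_poly D * cantor_ps ^+ 2 = 1.
Proof.
set y := _ * _; pose h := (p.-1)./2.
have pE : p = h.*2.+1 by rewrite /h -{1}(odd_double_half p) hodd; lia.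
have C0 : psc cantor_ps 0 = 1 by exact: cantor_seq0.
have Cn0 : cantor_ps != 0.
  by apply/eqP => C00; move/eqP: C0; rewrite C00 /= eq_sym oner_eq0.
have ps_exp (q : {poly 'F_p}) m : ps_of_poly (q ^+ m) = ps_of_poly q ^+ m.
  by elim: m => [|m IH]; rewrite ?expr0 // !exprS ps_of_polyM IH.
have yh : y ^+ h = 1.
  apply: (mulIf Cn0); rewrite mul1r [RHS]cantor_ps_fixpoint ps_exp -/h.
  have -> : cantor_ps ^+ p = (cantor_ps ^+ 2) ^+ h * cantor_ps.
    by rewrite -exprM mul2n -exprSr -pE.
  by rewrite /y exprMn mulrA.
have y0 : psc y 0 = 1.
  by rewrite pscM0 pscX0 C0 /= coefD coefXn coef1 expr1n mulr1 add0r.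
have /eqP : y ^+ h - 1 = 0 by rewrite yh subrr.
rewrite subrX1 mulf_eq0 subr_eq0 => /orP[/eqP //|/eqP s0].
have : psc (\sum_(i < h) y ^+ i) 0 = h%:R.
  rewrite psc_sum (eq_bigr (fun=> 1)) => [|i _]; last by rewrite pscX0 y0 expr1n.
  by rewrite sumr_const card_ord.
rewrite s0 /= => /esym/eqP; rewrite -(dvdn_pcharf (pchar_Fp hp)) => /dvdn_leq.
by have := prime_gt1 hp; lia.
Qed.

(** D is its own reciprocal polynomial: t^-2 (t^2 + 1) = 1 + X^2, and t^-2 comes from the factor
    t^-1 of Theta. *)
Lemma phi_Theta_sqr : phi (Theta_p p) ^+ 2 * embed D = 1.
Proof.
have ltV : tL 'F_p ^ (-1) = FracField.tofrac (psX 'F_p) by rewrite -invr_expz expr1z invrK.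
rewrite /phi /= ltV rmorphD rmorph1 rmorphXn /= embedX -[PSeries _]/cantor_ps.
rewrite -tofracM -tofracXn mulrDr mulr1 mulrC exprMn tofracM mulrA tLX_psX mul1r.
rewrite -tofracM -tofracD -{1}(mul1r (cantor_ps ^+ 2)) -mulrDl.
have -> : 1 + psX 'F_p ^+ 2 = ps_of_poly D.
  by apply: psP => n; rewrite pscD psc1 [psX _ ^+ 2]expr2 -ps_of_polyM -expr2 /= coefD coefXn coef1 addrC.
by rewrite cantor_ps_sqr tofrac1.
Qed.

End CantorSeries.

(** * Continued fractions of t^k / sqrt (t^2 + 1) *)

Section ContinuedFraction.
Variable F : fieldType.
Hypothesis two_neq0 : 2 != 0 :> F.
Implicit Types (P Q B C q r : {poly F}).

Local Notation K := {fraction (pseries F)}.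
Local Notation D := ('X^2 + 1 : {poly F}).

Lemma size_D : size D = 3.
Proof. by rewrite size_polyDl size_polyXn // size_poly1. Qed.

Lemma lead_D : lead_coef D = 1.
Proof. by rewrite lead_coefDl ?lead_coefXn // size_polyXn size_poly1. Qed.

Lemma D_neq0 : D != 0.
Proof. by rewrite -size_poly_eq0 size_D. Qed.

(** Otherwise D = s^2 for a polynomial s, so (s - t)(s + t) = 1 and both factors are constants, yet
    they differ by 2 t. *)
Lemma D_nonsquare q r : q ^+ 2 = D * r ^+ 2 -> r = 0.
Proof.
move=> e; apply/eqP; apply: contraT => r0.
have : r ^+ 2 %| q ^+ 2 by rewrite e dvdp_mull.
rewrite dvdp_pexp2r // => /dvdpP[s qs]; move: e; rewrite qs exprMn.
move/(mulIf (expf_neq0 2 r0)) => sD.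
have u1 : (s - 'X) * (s + 'X) = 1 by rewrite -subr_sqr sD addrC addKr.
have /eqP := congr1 (fun x : {poly F} => size x) u1.
have /andP[a0 b0] : (s - 'X != 0) && (s + 'X != 0).
  by rewrite -negb_or -mulf_eq0 u1 oner_eq0.
rewrite size_mul // size_poly1 => sz.
have : size (2 *: 'X : {poly F}) = 2 by rewrite size_scale ?size_polyX.
have -> : 2 *: 'X = (s + 'X) - (s - 'X) by rewrite scaler_nat; ring.
have := size_polyD (s + 'X) (- (s - 'X)); rewrite size_polyN.
move/eqP: sz a0 b0; rewrite -!size_poly_gt0; move: (size _) (size _) (size _) => a b c; lia.
Qed.

Lemma lc_weaken (x : K) (e f : int) c : e <= f -> lc x e c -> exists d, lc x f d.
Proof.
rewrite le_eqVlt => /orP[/eqP <- h|lt h]; first by exists c.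
by exists 0; apply: lc_lift h.
Qed.

Lemma lc_embed_size_le q (n : nat) c : lc (embed q) n%:Z c -> (size q <= n.+1)%N.
Proof.
have [->|q0 h] := eqVneq q 0; first by rewrite size_poly0.
have := lc_le _ (lc_embed q) h; rewrite lead_coef_eq0 => /(_ q0).
by move: q0; rewrite -size_poly_gt0; lia.
Qed.

Variable k : nat.
Hypothesis k_gt0 : (0 < k)%N.
Variable alpha : K.
Hypothesis alpha_sqr : alpha ^+ 2 * embed D = embed ('X^k ^+ 2).
Hypothesis lc_alpha : lc alpha (k%:Z - 1) 1.

Definition cf_chain (X : nat -> lser F) :=
  phi (X 0%N) = alpha /\ forall i, phi (X i.+1) * phi (lfrac (X i)) = 1.

Section Existence.

(** This is t^k sqrt D, which, unlike [alpha], is integral over the polynomials. *)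
Let S := alpha * embed D.

Lemma S_sqr : S ^+ 2 = embed ('X^k ^+ 2 * D).
Proof. by rewrite rmorphM /= -alpha_sqr /S; ring. Qed.

Lemma lc_S : lc S (k%:Z + 1) 1.
Proof.
have := lcM lc_alpha (lc_embed D); rewrite size_D lead_D mulr1.
by have -> : k%:Z - 1 + (3%:Z - 1) = k%:Z + 1 by lia.
Qed.

(* The complete quotients are (S + B) / C with B and C of bounded degree, as in Lagrange's theorem. *)
Definition cf_state (x : lser F) B C :=
  [/\ C != 0, phi x * embed C = S + embed B, C %| 'X^k ^+ 2 * D - B ^+ 2,
      (size C <= k.+2)%N & (size B <= k.+2)%N].

Lemma cf_state_start (x : lser F) : phi x = alpha -> cf_state x 0 D.
Proof.
move=> xa; split; rewrite ?xa ?D_neq0 ?rmorph0 ?addr0 ?size_poly0 ?size_D //.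
by rewrite expr0n subr0 dvdp_mull.
Qed.

(** The next state has B' = A C - B and C' = (t^(2k) D - B'^2) / C. Since S - B' is C times a
    fractional part, it has degree at most k, so B' shares the leading term of S and S + B' has
    leading coefficient 2. Hence deg B' = k + 1, and C' = (S - B')(S + B') / C has degree at most
    k. *)
Lemma cf_state_step (x : lser F) B C : cf_state x B C ->
  phi (lfrac x) != 0 /\
  forall y : lser F, phi y * phi (lfrac x) = 1 -> exists B' C', cf_state y B' C'.
Proof.
move=> [C0 xC dvdC szC szB].
pose A := lpolypart x; pose B' := A * C - B.
have iC0 : embed C != 0 by rewrite embed_eq0.
have fE : phi (lfrac x) * embed C = S - embed B'.
  have -> : phi (lfrac x) = phi x - embed A by rewrite (phi_split x) addrC addKr.
  by rewrite mulrBl xC rmorphB rmorphM /=; ring.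
have nsq : 'X^k ^+ 2 * D - B' ^+ 2 != 0.
  apply/eqP => /eqP; rewrite subr_eq0 mulrC => /eqP/esym/D_nonsquare/eqP.
  by rewrite expf_eq0 polyX_eq0 andbF.
have prodE : (S - embed B') * (S + embed B') = embed ('X^k ^+ 2 * D - B' ^+ 2).
  by rewrite -subr_sqr S_sqr [in RHS]rmorphB (rmorphXn _ 2 B').
have SB0 : S - embed B' != 0.
  by apply: contraNneq nsq => h; rewrite -embed_eq0 -prodE h mul0r.
have SB'0 : S + embed B' != 0.
  by apply: contraNneq nsq => h; rewrite -embed_eq0 -prodE h mulr0.
have f0 : phi (lfrac x) != 0.
  by apply: contraNneq SB0 => h; rewrite -fE h mul0r.
split=> // y yf.
have /dvdpP[C' C'E] : C %| 'X^k ^+ 2 * D - B' ^+ 2.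
  have -> : 'X^k ^+ 2 * D - B' ^+ 2 =
     ('X^k ^+ 2 * D - B ^+ 2) + C * (A * (B *+ 2) - A ^+ 2 * C) by rewrite /B'; ring.
  by rewrite dvdp_addr // dvdp_mulr.
have [c lcf] := lc_lfrac x.
have lcSB := lcM lcf (lc_embed C); rewrite fE in lcSB.
have sC0 : (0 < size C)%N by rewrite size_poly_gt0.
have [|d lcSBk] := lc_weaken (f := k%:Z) _ lcSB; first by lia.
have lcS2 : lc (S + embed B') (k%:Z + 1) 2.
  have -> : S + embed B' = (S + S) - (S - embed B') by ring.
  have -> : 2 = 1 + 1 - 0 :> F by rewrite subr0.
  by apply: lcD (lcD lc_S lc_S) (lcN _); apply: lc_lift lcSBk; lia.
have lcB' : lc (embed B') (k.+1)%:Z 1.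
  have -> : embed B' = (S + embed B') - S by ring.
  have -> : 1 = 2 - 1 :> F by ring.
  have -> : k.+1%:Z = k%:Z + 1 by lia.
  exact: lcD lcS2 (lcN lc_S).
exists B', C'; split; last exact: lc_embed_size_le lcB'.
- by apply: contraNneq nsq => h; rewrite C'E h mul0r.
- apply: (mulIf f0); apply: (mulIf iC0).
  rewrite -[RHS]mulrA fE [RHS]mulrC prodE C'E rmorphM /=.
  by rewrite -[embed C' * embed C]mul1r -yf; ring.
- by rewrite C'E dvdp_mulr.
apply: (@leq_trans k.+1) => //.
have : lc (embed C') k%:Z (c * lead_coef C * 2 * (lead_coef C)^-1).
  have -> : embed C' = (S - embed B') * (S + embed B') * (embed C)^-1.
    by rewrite prodE C'E rmorphM /= mulfK.
  have -> : k%:Z = -1 + ((size C)%:Z - 1) + (k%:Z + 1) + - ((size C)%:Z - 1) by lia.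
  apply: lcM (lcM lcSB lcS2) _; apply: lcV (lc_embed C).
  by rewrite lead_coef_eq0.
exact: lc_embed_size_le.
Qed.

Lemma cf_chain_exists (x : lser F) : phi x = alpha -> exists X, [/\ X 0%N = x,
  cf_chain X & forall i, exists B C, cf_state (X i) B C].
Proof.
move=> xa.
pose linv (y : lser F) : lser F :=
  if pselect (exists z : lser F, phi z * phi y = 1) is left h then projT1 (cid h) else y.
have linvE y : phi y != 0 -> phi (linv y) * phi y = 1.
  move=> y0; rewrite /linv; case: pselect => [h|]; first exact: projT2 (cid h).
  by case; apply: phi_inv.
pose X i := iter i (fun y => linv (lfrac y)) x.
have st i : exists B C, cf_state (X i) B C.
  elim: i => [|i [B [C /cf_state_step[f0 h]]]]; first by exists 0, D; exact: cf_state_start.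
  by apply: h; exact: linvE.
exists X; split=> //; split=> // i; apply: linvE.
by have [B [C /cf_state_step[f0 _]]] := st i.
Qed.

End Existence.

Section Convergents.
Variable X : nat -> lser F.
Hypothesis chainX : cf_chain X.
Local Notation A i := (lpolypart (X i)).

Lemma cf_size_gt1 i : (1 < size (A i.+1))%N.
Proof.
rewrite ltnNge; apply/negP => sz; have := chainX.2 i; have [c lcf] := lc_lfrac (X i).
have [c' lcf'] := lc_lfrac (X i.+1).
have : lc (phi (X i.+1)) 0 ((A i.+1)`_0 + 0).
  by rewrite (phi_split (X i.+1)); apply: lcD (lc_embed_coef sz) (lc_lift _ lcf').
move=> /lcM/(_ lcf); rewrite add0r => h e; rewrite e in h.
by have := lc_le (oner_neq0 F) (lc1 F) h.
Qed.

Lemma lc_complete_quotient i :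
  lc (phi (X i.+1)) (pdeg (A i.+1))%:Z (lead_coef (A i.+1)).
Proof.
have sz := cf_size_gt1 i; have [c lcf] := lc_lfrac (X i.+1).
rewrite (phi_split (X i.+1)) -[lead_coef _]addr0; apply: lcD; last exact: lc_lift lcf.
by rewrite lead_coefE; apply: lc_embed_coef; rewrite leqSpred.
Qed.

Lemma cf_pdeg_gt0 i : (0 < pdeg (A i.+1))%N.
Proof. by have := cf_size_gt1 i; rewrite /pdeg; case: size => [|[]]. Qed.

(* The degree of the denominator of the n-th convergent. *)
Definition cf_deg n := (\sum_(j < n) pdeg (A j.+1))%N.

Lemma cf_degS n : cf_deg n.+1 = (cf_deg n + pdeg (A n.+1))%N.
Proof. by rewrite /cf_deg big_ord_recr. Qed.

Lemma cf_deg_lt n : (cf_deg n < cf_deg n.+1)%N.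
Proof. by rewrite cf_degS -addn1 leq_add2l cf_pdeg_gt0. Qed.

Lemma cf_deg_ge n : (n <= cf_deg n)%N.
Proof. by elim: n => // n IH; apply: leq_ltn_trans (cf_deg_lt n). Qed.

Lemma convergents n : exists P Q, [/\ coprimep P Q, size Q = (cf_deg n).+1 &
  exists2 c, c != 0 & lc (embed Q * alpha - embed P) (- (cf_deg n.+1)%:Z) c].
Proof.
(* The induction carries the previous convergent P', Q', starting from 1, 0. Squaring the
   determinant hides its alternating sign and still yields a Bezout relation. The ratio of
   consecutive remainders is minus a complete quotient, which gives their degrees. *)
suff [P [Q [P' [Q' [det szQ szQ' RE lcR]]]]] : exists P Q P' Q',
  [/\ (P * Q' - P' * Q) ^+ 2 = 1, size Q = (cf_deg n).+1, (size Q' < size Q)%N,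
  embed Q' * alpha - embed P' = - phi (X n.+1) * (embed Q * alpha - embed P) &
  exists2 c, c != 0 & lc (embed Q * alpha - embed P) (- (cf_deg n.+1)%:Z) c].
  exists P, Q; split=> //; apply/Bezout_coprimepP.
  exists (Q' * (P * Q' - P' * Q), - P' * (P * Q' - P' * Q)).
  apply/eqpP; exists (1, 1); rewrite ?oner_eq0 // !scale1r -det /=; ring.
have lead0 i : lead_coef (A i.+1) != 0.
  by rewrite lead_coef_eq0 -size_poly_gt0; apply: ltn_trans (cf_size_gt1 i).
elim: n => [|n [P [Q [P' [Q' [det szQ szQ' RE [c c0 lcR]]]]]]].
  have fE : alpha - embed (A 0%N) = phi (lfrac (X 0%N)).
    by rewrite -chainX.1 (phi_split (X 0%N)) addrC addKr.
  exists (A 0%N), 1, 1, 0; split; first by ring.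
  - by rewrite size_poly1 /cf_deg big_ord0.
  - by rewrite size_poly0 size_poly1.
  - by rewrite !rmorph1 rmorph0 mul1r mul0r sub0r fE mulNr chainX.2.
  rewrite rmorph1 mul1r fE; exists (lead_coef (A 1%N))^-1; first by rewrite invr_eq0.
  have -> : phi (lfrac (X 0%N)) = (phi (X 1%N))^-1.
    have := chainX.2 0%N; set a := phi _; set b := phi _ => ab.
    have a0 : a != 0 by apply/eqP => a0; move/eqP: ab; rewrite a0 mul0r eq_sym oner_eq0.
    by apply: (mulfI a0); rewrite ab divff.
  rewrite cf_degS /cf_deg big_ord0 add0n.
  by apply: lcV (lc_complete_quotient 0).
have pA := cf_size_gt1 n.
have szAQ : size (A n.+1 * Q) = (cf_deg n.+1).+1.
  have Q0 : Q != 0 by rewrite -size_poly_gt0 szQ.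
  have A0 : A n.+1 != 0 by rewrite -lead_coef_eq0.
  by rewrite size_mul // szQ cf_degS /pdeg; move: pA; case: (size _) => // m; lia.
have szlt : (size Q' < size (A n.+1 * Q)%R)%N.
  by rewrite szAQ (leq_trans szQ') // szQ ltnS ltnW // cf_deg_lt.
exists (A n.+1 * P + P'), (A n.+1 * Q + Q'), P, Q; split.
- by rewrite -det; ring.
- by rewrite size_polyDl.
- by rewrite size_polyDl // szAQ szQ ltnS cf_deg_lt.
- rewrite !rmorphD !rmorphM /=.
  set f := embed Q * alpha - embed P.
  have -> : (embed (A n.+1) * embed Q + embed Q') * alpha - (embed (A n.+1) * embed P + embed P')
    = embed (A n.+1) * f + (embed Q' * alpha - embed P') by rewrite /f; ring.
  rewrite RE -/f (phi_split (X n.+1)).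
  transitivity (phi (X n.+2) * phi (lfrac (X n.+1)) * f); first by rewrite chainX.2 mul1r.
  by ring.
exists (- (c * (lead_coef (A n.+2))^-1)).
  by rewrite oppr_eq0 mulf_neq0 ?invr_eq0.
rewrite !rmorphD !rmorphM /=.
have -> : (embed (A n.+1) * embed Q + embed Q') * alpha - (embed (A n.+1) * embed P + embed P')
    = - ((embed Q * alpha - embed P) * (phi (X n.+2))^-1).
  have x0 : phi (X n.+2) != 0 by exact: lc_neq0 (lead0 _) (lc_complete_quotient _).
  apply: (mulIf x0); rewrite mulNr mulfVK //.
  have -> : (embed (A n.+1) * embed Q + embed Q') * alpha - (embed (A n.+1) * embed P + embed P')
    = embed (A n.+1) * (embed Q * alpha - embed P) + (embed Q' * alpha - embed P') by ring.
  rewrite RE (phi_split (X n.+1)) -[in RHS](mul1r (_ - _)) -(chainX.2 n.+1).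
  by ring.
have -> : - (cf_deg n.+2)%:Z = - (cf_deg n.+1)%:Z + - (pdeg (A n.+2))%:Z.
  by rewrite (cf_degS n.+1); lia.
by apply: lcN; apply: lcM => //; apply: lcV (lc_complete_quotient _).
Qed.

Definition cf_norm P Q := D * P ^+ 2 - 'X^k ^+ 2 * Q ^+ 2.

Lemma embed_cf_norm P Q : embed (cf_norm P Q) =
  - (embed D * (embed Q * alpha - embed P) * (embed P + embed Q * alpha)).
Proof.
have e (x : {poly F}) : embed (x ^+ 2) = embed x ^+ 2 by rewrite rmorphXn.
have eM (x y : {poly F}) : embed (x * y) = embed x * embed y by rewrite rmorphM.
rewrite /cf_norm rmorphB /= (eM D) (eM ('X^k ^+ 2)) -alpha_sqr !e.
by ring.
Qed.

(** Up to sign, N is the product of D, the remainder Q alpha - P of degree -d_(n+1), and P + Q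
    alpha. In the last factor the leading terms add up, as 2 is invertible, so its degree is d_n + k
    - 1. *)
Lemma convergent_norm n : exists P Q, [/\ coprimep P Q, size Q = (cf_deg n).+1,
  size P = (cf_deg n + k)%N &
  (size (cf_norm P Q) + cf_deg n.+1 = k.+2 + cf_deg n)%N].
Proof.
have [P [Q [cPQ szQ [c c0 lcR]]]] := convergents n; exists P, Q.
have Q0 : lead_coef Q != 0 by rewrite lead_coef_eq0 -size_poly_gt0 szQ.
have lcQa := lcM (lc_embed Q) lc_alpha; rewrite mulr1 in lcQa.
have lcP : lc (embed P) ((size Q)%:Z - 1 + (k%:Z - 1)) (lead_coef Q).
  have -> : embed P = embed Q * alpha + - (embed Q * alpha - embed P) by ring.
  rewrite -[lead_coef Q]addr0; apply: lcD lcQa _; apply: lc_lift (lcN lcR).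
  by rewrite szQ; have := cf_deg_lt n; lia.
have lcs : lc (embed P + embed Q * alpha) ((size Q)%:Z - 1 + (k%:Z - 1)) (lead_coef Q * 2).
  by rewrite mulr_natr mulr2n; exact: lcD.
have lcN := lcN (lcM (lcM (lc_embed D) lcR) lcs); rewrite -embed_cf_norm in lcN.
split=> //.
  by have := lc_embed_size Q0 lcP; rewrite szQ; lia.
have := lc_embed_size _ lcN; rewrite size_D lead_D mul1r oppr_eq0 !mulf_neq0 // => /(_ isT).
by rewrite szQ; lia.
Qed.

(** The converse of [convergent_norm], by the argument for best approximations. Equality of the
    leading coefficients makes P / Q approximate [alpha] and not its conjugate - [alpha]. *)
Lemma norm_convergent P Q : coprimep P Q -> Q != 0 ->
  size P = (size Q + k.-1)%N -> lead_coef P = lead_coef Q ->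
  cf_norm P Q != 0 -> (size (cf_norm P Q) <= k.+1)%N ->
  exists2 n, size Q = (cf_deg n).+1 &
    (size (cf_norm P Q) + cf_deg n.+1 = k.+2 + cf_deg n)%N.
Proof.
move=> cPQ Q0 szP leadPQ N0 szN.
have sQ0 : (0 < size Q)%N by rewrite size_poly_gt0.
have sN0 : (0 < size (cf_norm P Q))%N by rewrite size_poly_gt0.
have lQ0 : lead_coef Q != 0 by rewrite lead_coef_eq0.
have lcQa := lcM (lc_embed Q) lc_alpha; rewrite mulr1 in lcQa.
have lcs : lc (embed P + embed Q * alpha) ((size P)%:Z - 1) (lead_coef Q * 2).
  rewrite mulr_natr mulr2n -{1}leadPQ; apply: lcD (lc_embed P) _.
  by have -> : (size P)%:Z - 1 = (size Q)%:Z - 1 + (k%:Z - 1) by lia.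
(* The remainder Q alpha - P has degree -e, read off from the factorisation of the norm; deg N <= k
   makes e exceed deg Q. *)
set e : int := (size P)%:Z + 2 - (size (cf_norm P Q))%:Z.
have [c c0 lcR] : exists2 c, c != 0 & lc (embed Q * alpha - embed P) (- e) c.
  have den0 : lead_coef Q * 2 != 0 by rewrite mulf_neq0.
  have -> : embed Q * alpha - embed P =
    - (embed (cf_norm P Q) * ((embed D)^-1 * (embed P + embed Q * alpha)^-1)).
    rewrite embed_cf_norm mulNr opprK.
    have s0 := lc_neq0 den0 lcs; have d0 : embed D != 0 by rewrite embed_eq0 D_neq0.
    have gen (L : fieldType) (a x b : L) : a != 0 -> b != 0 -> x = a * x * b * (a^-1 * b^-1).
      by move=> a0 b0; field; rewrite a0 b0.
    exact: gen.
  eexists; last first.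
    have -> : - e = ((size (cf_norm P Q))%:Z - 1) + (- ((size D)%:Z - 1) + - ((size P)%:Z - 1)).
      by rewrite size_D /e; lia.
    apply: lcN; apply: lcM (lc_embed _) (lcM (lcV _ (lc_embed D)) (lcV _ lcs)) => //.
    by rewrite lead_D oner_eq0.
  by rewrite oppr_eq0 !mulf_neq0 ?invr_eq0 ?lead_D ?lead_coef_eq0 ?oner_eq0.
have ltQe : (size Q)%:Z - 1 < e by rewrite /e szP; lia.
have ex : exists n, (cf_deg n <= (size Q).-1)%N by exists 0%N; rewrite /cf_deg big_ord0.
have bnd n : (cf_deg n <= (size Q).-1)%N -> (n <= (size Q).-1)%N.
  by apply: leq_trans; exact: cf_deg_ge.
have [n len maxn] := ex_maxnP ex bnd.
have ltn : ((size Q).-1 < cf_deg n.+1)%N.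
  by rewrite ltnNge; apply/negP => /maxn; rewrite ltnn.
have [Pn [Qn [cPn szQn [d d0 lcRn]]]] := convergents n.
have Qn0 : Qn != 0 by rewrite -size_poly_gt0 szQn.
have lcl := lcM (lc_embed Qn) lcR; have lcr := lcM (lc_embed Q) lcRn.
(* With d_n <= deg Q < d_(n+1), both products of a denominator with the other remainder have
   negative degree; their difference is a polynomial, hence 0. *)
have det : Q * Pn = P * Qn.
  apply/eqP; rewrite -subr_eq0; apply/eqP.
  have [|u lcu] := lc_weaken (f := -1) _ lcl; first by rewrite szQn; move: len ltQe sQ0; clear; lia.
  have [|v lcv] := lc_weaken (f := -1) _ lcr; first by move: ltn sQ0; clear; lia.
  apply: (@lc_embed_neg _ _ (-1) (u + - v)) => //.
  have -> : embed (Q * Pn - P * Qn) = embed Qn * (embed Q * alpha - embed P)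
     + - (embed Q * (embed Qn * alpha - embed Pn)).
    by rewrite rmorphB !rmorphM /=; ring.
  by apply: lcD lcu (lcN lcv).
have eqQ : Q %= Qn.
  apply/andP; split.
    by rewrite -(Gauss_dvdpr Qn (_ : coprimep Q P)) 1?coprimep_sym // -det dvdp_mulr.
  by rewrite -(Gauss_dvdpl Q (_ : coprimep Qn Pn)) 1?coprimep_sym // det dvdp_mull.
have szQ := eqp_size eqQ.
exists n; first by rewrite szQ.
have RE : embed Qn * (embed Q * alpha - embed P) = embed Q * (embed Qn * alpha - embed Pn).
  have := congr1 (@embed F) det; rewrite !rmorphM /= => h.
  by rewrite !mulrBr [embed Q * embed Pn]h; ring.
rewrite RE in lcl.
have := lc_uniq _ _ lcl lcr; rewrite !mulf_neq0 ?lead_coef_eq0 // => /(_ isT isT).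
by rewrite szQ szQn /e szP szQ szQn; move: k_gt0; clear; lia.
Qed.

End Convergents.

End ContinuedFraction.

(** * The norm equation in characteristic p *)

Section NormEquation.
Variable p : nat.
Hypotheses (hp : prime p) (hodd : odd p).
Implicit Types (a b w U V P Q N : {poly 'F_p}).

Local Notation D := ('X^2 + 1 : {poly 'F_p}).

Let p_gt0 : (0 < p)%N := prime_gt0 hp.
Let p_gt1 : (1 < p)%N := prime_gt1 hp.

Lemma odd_prime_half : p = (p.-1)./2.*2.+1.
Proof. by rewrite -{1}(odd_double_half p) hodd; lia. Qed.

Lemma Fp_natr_neq0 n : (0 < n < p)%N -> n%:R != 0 :> 'F_p.
Proof.
move=> /andP[n0 ltnp]; rewrite -(dvdn_pcharf (pchar_Fp hp)).
by apply/negP => /dvdn_leq; rewrite n0 leqNgt ltnp => /(_ isT).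
Qed.

Lemma two_neq0_Fp : 2 != 0 :> 'F_p.
Proof. by apply: Fp_natr_neq0; move: p_gt1 hodd; case: (p) => [|[|[|]]]. Qed.

Lemma expp_deriv w : (w ^+ p)^`() = 0.
Proof. by rewrite deriv_exp -mulr_natr -polyC_natr pchar_Fp_0 // polyC0 mulr0. Qed.

Lemma deriv_eq0_root a : a^`() = 0 -> exists b, a = b ^+ p.
Proof.
move=> a'0; exists (\poly_(i < size a) a`_(i * p)); rewrite poly_expp //.
apply/polyP => i; rewrite coef_comp_poly_Xn // coef_poly; case: ifP => [pi|npi].
  rewrite divnK //; case: ltnP => // h; rewrite nth_default //.
  by rewrite (leq_trans h) // leq_div.
case: i npi => [|i npi]; first by rewrite dvdn0.
have := congr1 (fun q : {poly 'F_p} => q`_i) a'0.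
rewrite coef_deriv coef0 -mulr_natr => /eqP; rewrite mulf_eq0 -(dvdn_pcharf (pchar_Fp hp)) npi.
by rewrite orbF => /eqP.
Qed.

Lemma deriv_D : D^`() = 'X *+ 2.
Proof. by rewrite derivD derivXn -['X^_]/'X -polyC1 derivC addr0. Qed.

Lemma coprimep_DX : coprimep D 'X.
Proof. by rewrite coprimepX rootE !hornerE expr0n add0r oner_eq0. Qed.

(* Differentiating D^j s = w^p gives D | j D' s, so the exponent of D can be raised up to p. *)
Lemma dvdp_D_expp w : D %| w ^+ p -> D %| w.
Proof.
move=> Dw; rewrite -(dvdp_pexp2r _ _ p_gt0).
suff h j : (j.+1 <= p)%N -> D ^+ j.+1 %| w ^+ p.
  by have := h p.-1; rewrite prednK // => ->.
elim: j => [|j IH] hj; first by rewrite expr1.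
have /dvdpP[s es] := IH (ltnW hj).
suff /dvdpP[r er] : D %| s by rewrite es er exprS -mulrA dvdp_mulIr.
have := expp_deriv w; rewrite es derivM deriv_exp deriv_D.
have -> : s^`() * D ^+ j.+1 + s * ('X *+ 2 * D ^+ j *+ j.+1) =
  D ^+ j * (s^`() * D + s * 'X *+ (2 * j.+1)) by rewrite exprS; ring.
move/eqP; rewrite mulf_eq0 expf_eq0 (negPf (D_neq0 _)) andbF /= => /eqP e.
have : D %| s * 'X *+ (2 * j.+1).
  by rewrite -(dvdp_addr _ (_ : D %| s^`() * D)) ?e ?dvdp0 // dvdp_mulIr.
rewrite -mulr_natl -polyC_natr mul_polyC dvdpZr; last first.
  by rewrite natrM mulf_neq0 ?two_neq0_Fp ?Fp_natr_neq0.
by rewrite Gauss_dvdpl // coprimep_DX.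
Qed.

(* The numerator of the logarithmic derivative of sqrt D V / U. *)
Definition wronskian U V := D * (V^`() * U - V * U^`()) + 'X * U * V.

(** Eliminating V' between N and N' gives 2 V W = 2 N U' - N' U for the wronskian W. The right side
    has degree below deg N + deg U = deg N + deg V + 1. *)
Lemma size_wronskian U V : V != 0 -> size U = (size V).+1 ->
  U ^+ 2 - D * V ^+ 2 != 0 ->
  (size (wronskian U V) <= size (U ^+ 2 - D * V ^+ 2)%R)%N.
Proof.
move=> V0 sU; set N := _ - _ => N0.
have eN : 2 *: (V * wronskian U V) = 2 *: (N * U^`()) - N^`() * U.
  by rewrite !scaler_nat /wronskian /N derivB !expr2 !derivM deriv_D; ring.
have [->|E0] := eqVneq (wronskian U V) 0; first by rewrite size_poly0.
have U0 : U != 0 by rewrite -size_poly_gt0 sU.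
have sV : (0 < size V)%N by rewrite size_poly_gt0.
have sE : (0 < size (wronskian U V))%N by rewrite size_poly_gt0.
have sN : (0 < size N)%N by rewrite size_poly_gt0.
have := congr1 (fun q : {poly 'F_p} => size q) eN; rewrite /= size_scale ?two_neq0_Fp // size_mul // => eq1.
have := size_polyD (2 *: (N * U^`())) (- (N^`() * U)).
rewrite size_polyN size_scale ?two_neq0_Fp // -eq1.
have := size_polyMleq N U^`(); have := size_polyMleq N^`() U.
have := lt_size_deriv U0; have := lt_size_deriv N0.
move: sV sE sN sU; clear.
move: (size (N * _)) (size (_ * U)) (size N^`()) (size U^`()) (size N) (size U) (size V).
move: (size (wronskian _ _)) => c1 c2 c3 c4 c5 c6 c7 c8; lia.
Qed.

Lemma deriv_expp_mul w (c : {poly 'F_p}) : (w ^+ p * c)^`() = w ^+ p * c^`().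
Proof. by rewrite derivM expp_deriv mul0r add0r. Qed.

Lemma deriv_Xn_mul n (c : {poly 'F_p}) : (p %| n)%N -> ('X^n * c)^`() = 'X^n * c^`().
Proof. by case/dvdnP => m ->; rewrite exprM deriv_expp_mul. Qed.

(* D b' + t b = 0 says that D^((p+1)/2) b has derivative 0. *)
Lemma wronskian_eq0_roots a b : a != 0 -> coprimep a b -> coprimep a D ->
  wronskian a b = 0 ->
  exists a1 b1, a = a1 ^+ p /\ b = D ^+ (p.-1)./2 * b1 ^+ p.
Proof.
move=> a0 cab caD w0; set h := (p.-1)./2.
have e : D * b * a^`() = (D * b^`() + 'X * b) * a.
  by apply/eqP; rewrite eq_sym -subr_eq0 -w0 /wronskian; apply/eqP; ring.
(* Being coprime to D b, a divides its own derivative, which has smaller degree. *)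
have a'0 : a^`() = 0.
  apply/eqP; apply: contraT => a'0.
  have : a %| D * b * a^`() by rewrite e dvdp_mull.
  rewrite Gauss_dvdpr ?coprimepMr ?caD // => /(dvdp_leq a'0).
  by rewrite leqNgt lt_size_deriv.
have [a1 ea] := deriv_eq0_root a'0.
have eb : D * b^`() + 'X * b = 0.
  by apply/eqP; move/eqP: e; rewrite a'0 mulr0 eq_sym mulf_eq0 (negPf a0) orbF.
have : (D ^+ h.+1 * b)^`() = 0.
  (* As 2 (h + 1) = p + 1 is 1 mod p, the derivative of D^(h+1) is t D^h. *)
  have hE : h.+1%:R * 2 = 1 :> {poly 'F_p}.
    have pE : (h.+1 * 2 = p + 1)%N by have := odd_prime_half; rewrite -/h; lia.
    by rewrite -natrM pE natrD -polyC_natr pchar_Fp_0 // polyC0 add0r.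
  rewrite derivM deriv_exp deriv_D -[_.-1]/h -(mulr_natl _ h.+1).
  move: hE; set m := h.+1%:R => hE.
  transitivity (D ^+ h * (m * 2 * ('X * b) + D * b^`())); first by rewrite (exprS D h); set Dh := D ^+ h; clearbody Dh; ring.
  by rewrite hE mul1r [X in _ * X]addrC eb mulr0.
move=> /deriv_eq0_root[w ew].
have /dvdpP[w1 ew1] : D %| w by apply: dvdp_D_expp; rewrite -ew (exprS D h) -mulrA dvdp_mulIl.
exists a1, w1; split=> //; have Dh0 : D ^+ h.+1 != 0 by rewrite expf_neq0 // D_neq0.
apply: (mulfI Dh0); rewrite ew ew1 exprMn mulrC mulrA -exprD addSn addnn.
by rewrite -odd_prime_half.
Qed.

Lemma size_exp_neq0 w n : w != 0 -> size (w ^+ n) = ((size w).-1 * n).+1.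
Proof. by move=> w0; rewrite -size_exp prednK // size_poly_gt0 expf_neq0. Qed.

Lemma odd_prime_mul n : odd (n * p) = odd n.
Proof. by rewrite oddM hodd andbT. Qed.

Lemma coprimep_XnD n : coprimep 'X^n D.
Proof. by rewrite coprimep_expl // coprimep_sym coprimep_DX. Qed.

(** The factor D^h has degree q - 1; with the 1 in deg U = deg V + 1 this makes exactly one q, so
    the same relation holds for the roots. *)
Lemma descent_size u v h q : (0 < u)%N -> (0 < v)%N -> q = h.*2.+1 ->
  ((u.-1 * q).+1 = ((2 * h).+1 + (v.-1 * q).+1).-1.+1)%N -> u = v.+1.
Proof.
case: u v => [|u] [|v] //= _ _ -> e; congr _.+1; apply/eqP.
by rewrite -(eqn_pmul2r (ltn0Sn h.*2)) mulSn; apply/eqP; lia.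
Qed.

(* Taking p-th roots s times brings the degree of the norm down to at most 1; it is even, hence 0.
   The boolean e tells which of U and V carries the power of t. *)
Lemma small_norm s (e : bool) a b
    (U := 'X^(e * 2 * p ^ s) * a) (V := 'X^(~~ e * 2 * p ^ s) * b) :
  a != 0 -> b != 0 -> coprimep a b -> coprimep a D -> size U = (size V).+1 ->
  odd (size (U ^+ 2 - D * V ^+ 2)%R) ->
  (size (U ^+ 2 - D * V ^+ 2)%R <= 2 * p ^ s)%N ->
  size (U ^+ 2 - D * V ^+ 2) = 1 /\ (p ^ s.+1 %| (size U).-1)%N.
Proof.
rewrite {}/U {}/V; elim: s a b => [|s IH] a b a0 b0 cab caD.
  rewrite expn0 !muln1 expn1; set U := _ * a; set V := _ * b => sU oN leN.
  have sN : size (U ^+ 2 - D * V ^+ 2) = 1 by move: oN leN; case: size => [|[|[]]].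
  have N0 : U ^+ 2 - D * V ^+ 2 != 0 by rewrite -size_poly_gt0 sN.
  have V0 : V != 0 by rewrite mulf_neq0 // expf_neq0 // polyX_eq0.
  have U0 : U != 0 by rewrite mulf_neq0 // expf_neq0 // polyX_eq0.
  (* One of U, V is divisible by t^2, so t divides the wronskian, whose degree is at most deg N =
     0. *)
  have w0 : wronskian U V = 0.
    have [c ec] : exists c, wronskian U V = 'X * c.
      rewrite /wronskian /U /V; case: (e) => /=.
        exists (D * (b^`() * 'X * a - b * (a *+ 2 + 'X * a^`())) + 'X^2 * a * b).
        by rewrite mul1n mul0n expr0 mul1r derivM derivXn /=; ring.
      exists (D * ((b *+ 2 + 'X * b^`()) * a - 'X * b * a^`()) + 'X^2 * a * b).
      by rewrite mul0n mul1n expr0 mul1r derivM derivXn /=; ring.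
    apply/eqP; apply: contraT => w0; have := size_wronskian V0 sU N0.
    have c0 : c != 0 by apply: contraNneq w0 => c0; rewrite ec c0 mulr0.
    by rewrite sN ec (mulrC 'X) size_mulX // ltnS leqn0 size_poly_eq0 (negPf c0).
  have cUV : coprimep U V.
    have [c c0 ec] : exists2 c, c != 0 & U ^+ 2 - D * V ^+ 2 = c%:P.
      by have /eqP/size_poly1P := sN.
    apply/Bezout_coprimepP; exists (U, - (D * V)); apply/eqpP; exists (1, c); rewrite ?oner_eq0 //=.
    by rewrite scale1r -mul_polyC mulr1 -ec; ring.
  have cUD : coprimep U D by rewrite coprimepMl coprimep_XnD.
  have [u [_ [eu _]]] := wronskian_eq0_roots U0 cUV cUD w0.
  split=> //; rewrite eu size_exp_neq0 ?dvdn_mull //.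
  by apply: contraNneq U0 => u0; rewrite eu u0 expr0n -[p]prednK.
set x := (e * 2)%N; set y := (~~ e * 2)%N => sU oN leN.
have pd n : (p %| n * p ^ s.+1)%N by rewrite expnS dvdn_mull // dvdn_mulr.
have N0 : ('X^(x * p ^ s.+1) * a) ^+ 2 - D * ('X^(y * p ^ s.+1) * b) ^+ 2 != 0.
  by rewrite -size_poly_gt0; move: oN; case: size.
have V0 : 'X^(y * p ^ s.+1) * b != 0 by rewrite mulf_neq0 // expf_neq0 // polyX_eq0.
have w0 : wronskian a b = 0.
  (* A power of t with exponent divisible by p acts as a constant under derivation. The factor t^(2
     p^(s+1)) so obtained exceeds the degree allowed by [size_wronskian], unless the wronskian is
     0. *)
  have ew : wronskian ('X^(x * p ^ s.+1) * a) ('X^(y * p ^ s.+1) * b) =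
      'X^(2 * p ^ s.+1) * wronskian a b.
    have -> : (2 * p ^ s.+1 = x * p ^ s.+1 + y * p ^ s.+1)%N.
      by rewrite -mulnDl /x /y; case: (e).
    by rewrite /wronskian !deriv_Xn_mul // exprD; ring.
  apply/eqP; apply: contraT => w0; have := size_wronskian V0 sU N0.
  rewrite ew mulrC size_mulXn // => /leq_trans/(_ leN); rewrite -{2}[(2 * _)%N]addn0 leq_add2l.
  by rewrite leqn0 size_poly_eq0 (negPf w0).
have [a1 [b1 [ea eb]]] := wronskian_eq0_roots a0 cab caD w0.
set h := (p.-1)./2 in eb.
have a10 : a1 != 0 by apply: contraNneq a0 => u0; rewrite ea u0 expr0n -[p]prednK.
have b10 : b1 != 0 by apply: contraNneq b0 => u0; rewrite eb u0 expr0n -[p]prednK // mulr0.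
have Xp n : 'X^(n * p ^ s.+1) = ('X^(n * p ^ s)) ^+ p :> {poly 'F_p}.
  by rewrite -exprM expnSr mulnA.
pose U1 := 'X^(x * p ^ s) * a1; pose V1 := 'X^(y * p ^ s) * b1.
have U10 : U1 != 0 by rewrite mulf_neq0 // expf_neq0 // polyX_eq0.
have V10 : V1 != 0 by rewrite mulf_neq0 // expf_neq0 // polyX_eq0.
have eU : 'X^(x * p ^ s.+1) * a = U1 ^+ p by rewrite Xp ea exprMn.
have eV : 'X^(y * p ^ s.+1) * b = D ^+ h * V1 ^+ p by rewrite Xp eb exprMn mulrCA.
(* Since D (D^h)^2 = D^p, the norm is the p-th power of the norm of the roots, which is what lets
   the descent repeat. *)
have eN : (U1 ^+ p) ^+ 2 - D * (D ^+ h * V1 ^+ p) ^+ 2 = (U1 ^+ 2 - D * V1 ^+ 2) ^+ p.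
  have DE : D * (D ^+ h) ^+ 2 = D ^+ p by rewrite -exprM muln2 -exprS -odd_prime_half.
  rewrite (exprMn 2 (D ^+ h) (V1 ^+ p)) (mulrA D) DE (exprAC U1 p 2) (exprAC V1 p 2) -(exprMn p D).
  by rewrite -!(pFrobenius_autE (pchar_polyFp hp)) rmorphB.
rewrite eU eV eN in sU oN leN N0 *.
have N10 : U1 ^+ 2 - D * V1 ^+ 2 != 0.
  by apply: contraNneq N0 => u0; rewrite u0 expr0n -[p]prednK.
have sU1 : (0 < size U1)%N by rewrite size_poly_gt0.
have sV1 : (0 < size V1)%N by rewrite size_poly_gt0.
have sN1 : (0 < size (U1 ^+ 2 - D * V1 ^+ 2)%R)%N by rewrite size_poly_gt0.
rewrite size_exp_neq0 // in oN; rewrite size_exp_neq0 // in leN; rewrite !size_exp_neq0 //.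
have sDh : size (D ^+ h) = (2 * h).+1.
  by rewrite size_exp_neq0 ?D_neq0 // size_D.
have Dh0 : D ^+ h != 0 by rewrite expf_neq0 // D_neq0.
have V1p0 : V1 ^+ p != 0 by rewrite expf_neq0.
rewrite (size_mul Dh0 V1p0) (size_exp_neq0 p V10) (size_exp_neq0 p U10) sDh in sU.
have [] := IH a1 b1 a10 b10.
- by move: cab; rewrite ea eb coprimep_pexpl // coprimepMr => /andP[_]; rewrite coprimep_pexpr.
- by move: caD; rewrite ea coprimep_pexpl.
- exact: descent_size sU1 sV1 odd_prime_half sU.
- by rewrite -(prednK sN1) /= -odd_prime_mul.
- rewrite -(prednK sN1) -(ltn_pmul2r p_gt0) (leq_trans leN) //.
  by rewrite -mulnA -expnSr.
rewrite -/U1 -/V1 => -> d; split=> //=.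
by rewrite expnSr dvdn_pmul2r.
Qed.

End NormEquation.

(** * Parity of the convergents *)

Section Parity.
Variable p : nat.
Hypotheses (hp : prime p) (hodd : odd p).
Implicit Types (P Q : {poly 'F_p}).

Local Notation D := ('X^2 + 1 : {poly 'F_p}).

Definition flip P := P \Po (- 'X).

Lemma flipD P Q : flip (P + Q) = flip P + flip Q. Proof. exact: comp_polyD. Qed.
Lemma flipB P Q : flip (P - Q) = flip P - flip Q. Proof. exact: comp_polyB. Qed.
Lemma flipM P Q : flip (P * Q) = flip P * flip Q. Proof. exact: comp_polyM. Qed.
Lemma flip_sqr P : flip (P ^+ 2) = flip P ^+ 2. Proof. by rewrite !expr2 flipM. Qed.
Lemma flipK P : flip (flip P) = P.
Proof.
by rewrite /flip -comp_polyA -[- 'X]scaleN1r comp_polyZ comp_polyX scalerA mulrNN mulr1 scale1r comp_polyXr.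
Qed.
Lemma flip_X2 : flip 'X^2 = 'X^2.
Proof. by rewrite /flip comp_Xn_poly sqrrN. Qed.
Lemma flip_Xn2 n : flip ('X^n ^+ 2) = 'X^n ^+ 2.
Proof.
by rewrite /flip rmorphXn /= comp_Xn_poly -!exprM mulnC !exprM sqrrN.
Qed.
Lemma flip_D : flip D = D.
Proof. by rewrite flipD flip_X2 /flip -polyC1 comp_polyC. Qed.

Lemma size_opp_X : size (- 'X : {poly 'F_p}) = 2.
Proof. by rewrite size_polyN size_polyX. Qed.

Lemma size_flip P : size (flip P) = size P.
Proof. by rewrite size_comp_poly2 // size_opp_X. Qed.

Lemma lead_flip P : lead_coef (flip P) = lead_coef P * (-1) ^+ (size P).-1.
Proof. by rewrite lead_coef_comp ?size_opp_X // lead_coefN lead_coefX. Qed.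

Lemma horner_flip P x : (flip P).[x] = P.[- x].
Proof. by rewrite horner_comp !hornerE. Qed.

Variable k : nat.
Hypotheses (k_even : ~~ odd k) (k_gt0 : (0 < k)%N).

(* t^k / sqrt D is an odd function of t, so the approximation P(-t)/Q(-t) is as close to
   -t^k / sqrt D as P/Q is to t^k / sqrt D; hence the two agree up to sign. *)
Lemma flip_convergent P Q : coprimep P Q -> Q != 0 -> size P = (size Q + k.-1)%N ->
  (size (cf_norm k P Q) <= k.+1)%N ->
  exists2 c, c ^+ 2 = 1 & flip Q = c *: Q /\ flip P = - c *: P.
Proof.
move=> cPQ Q0 sP sN; set N := cf_norm k P Q.
have P0 : P != 0 by rewrite -size_poly_gt0 sP; move: Q0; rewrite -size_poly_gt0; lia.
pose Z := P * flip Q + flip P * Q; pose M := P * flip Q - flip P * Q.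
have eq1 : D * (Z * M) = N * flip Q ^+ 2 - flip N * Q ^+ 2.
  rewrite /N /cf_norm flipB (flipM D) (flipM ('X^k ^+ 2)) flip_D flip_Xn2 !flip_sqr /Z /M.
  by ring.
(* deg P and deg Q differ by the odd number k - 1, so the leading terms of the two products in M
   reinforce each other. *)
have sM : (size P + size Q).-1%N = size M.
  have cM : M`_(size P + size Q).-2 != 0.
    have c1 : (P * flip Q)`_(size P + size Q).-2 = lead_coef P * lead_coef Q * (-1) ^+ (size Q).-1.
      by rewrite -mulrA -lead_flip -lead_coefM lead_coefE size_mul -?size_poly_eq0 ?size_flip ?size_poly_eq0.
    have c2 : (flip P * Q)`_(size P + size Q).-2 = lead_coef P * lead_coef Q * (-1) ^+ (size P).-1.
      by rewrite mulrAC -lead_flip -lead_coefM lead_coefE size_mul -?size_poly_eq0 ?size_flip ?size_poly_eq0.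
    rewrite coefB c1 c2.
    have -> : (-1) ^+ (size P).-1 = - (-1) ^+ (size Q).-1 :> 'F_p.
      have -> : (size P).-1 = ((size Q).-1 + k.-1)%N by rewrite sP; move: Q0; rewrite -size_poly_gt0; lia.
      rewrite exprD -[in (-1) ^+ k.-1]signr_odd.
      have -> : odd k.-1 by move: k_even k_gt0; case: (k) => // n /=; rewrite negbK.
      by rewrite expr1 mulrN1.
    rewrite mulrN opprK -mulr2n -mulr_natr !mulf_neq0 ?lead_coef_eq0 ?two_neq0_Fp //.
    by rewrite signr_eq0.
  apply/eqP; rewrite eqn_leq; apply/andP; split.
    have : ((size P + size Q).-2 < size M)%N.
      by rewrite ltnNge; apply: contra cM => h; rewrite nth_default.
    by move: P0 Q0; rewrite -!size_poly_gt0; lia.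
  rewrite (leq_trans (size_polyD _ _)) // size_polyN geq_max.
  by rewrite !(leq_trans (size_polyMleq _ _)) ?size_flip.
(* Otherwise D Z M has degree at least 2 + deg P + deg Q = 2 deg Q + k + 1, while the right side of
   [eq1] has degree at most 2 deg Q + k. *)
have Z0 : Z = 0.
  apply/eqP; apply: contraT => Z0.
  have M0 : M != 0.
    by rewrite -size_poly_gt0 -sM; move: P0 Q0; rewrite -!size_poly_gt0; lia.
  have := congr1 (fun q : {poly 'F_p} => size q) eq1.
  rewrite /= size_mul ?mulf_neq0 ?D_neq0 // size_D size_mul // -sM sP => h.
  have := size_polyD (N * flip Q ^+ 2) (- (flip N * Q ^+ 2)).
  rewrite -h size_polyN.
  have := size_polyMleq N (flip Q ^+ 2); have := size_polyMleq (flip N) (Q ^+ 2).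
  have := size_poly_exp_leq Q 2; have := size_poly_exp_leq (flip Q) 2.
  rewrite !size_flip; move: sN Z0 Q0 k_gt0; rewrite -!size_poly_gt0 -/N; clear.
  move: (size (N * _)%R) (size (flip N * _)%R) (size (flip Q ^+ 2)%R) (size (Q ^+ 2)%R).
  by move: (size Z) (size N) (size Q); lia.
have eZ : P * flip Q = - (flip P * Q) by apply/eqP; rewrite -addr_eq0 -/Z Z0.
have eqQ : flip Q %= Q.
  rewrite eqp_sym -dvdp_size_eqp ?size_flip //.
  by rewrite -(Gauss_dvdpr _ (_ : coprimep Q P)) 1?coprimep_sym // eZ dvdpNr dvdp_mull.
have [c c0 eQ] : exists2 c, c != 0 & flip Q = c *: Q.
  have /eqpP[[c1 c2] /= /andP[c10 c20] e] := eqQ.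
  exists (c1^-1 * c2); first by rewrite mulf_neq0 ?invr_eq0.
  by rewrite -scalerA -e scalerA mulVf // scale1r.
exists c.
  have := flipK Q; rewrite {2}/flip -/(flip _) eQ /flip comp_polyZ -/(flip _) eQ scalerA => e.
  by have := congr1 lead_coef e; rewrite lead_coefZ -{2}[lead_coef Q]mul1r => /mulIf; apply; rewrite lead_coef_eq0.
split=> //; apply: (mulIf Q0); rewrite -[LHS]opprK -eZ eQ.
by rewrite -!scalerAl -scalerAr scaleNr.
Qed.

(** The signs cancel in the squares, so the norm is invariant under t -> -t and has even degree. *)
Lemma odd_size_norm P Q : coprimep P Q -> Q != 0 -> size P = (size Q + k.-1)%N ->
  (size (cf_norm k P Q) <= k.+1)%N -> cf_norm k P Q != 0 ->
  odd (size (cf_norm k P Q)).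
Proof.
move=> cPQ Q0 sP sN N0; have [c c2 [eQ eP]] := flip_convergent cPQ Q0 sP sN.
have fN : flip (cf_norm k P Q) = cf_norm k P Q.
  rewrite /cf_norm flipB (flipM D) (flipM ('X^k ^+ 2)) flip_D flip_Xn2 !flip_sqr eQ eP.
  by rewrite !exprZn sqrrN c2 !scale1r.
have := lead_flip (cf_norm k P Q); rewrite fN -{1}[lead_coef _]mulr1.
move/mulfI; rewrite lead_coef_eq0 => /(_ N0).
rewrite -signr_odd; move: N0; rewrite -size_poly_gt0; case: (size _) => //= n _.
case: (odd n) => //; rewrite expr1 => /eqP.
by rewrite -subr_eq0 opprK -mulr2n (negPf (two_neq0_Fp hp hodd)).
Qed.

(* Q is invariant up to sign under t -> -t, while no proper factor of D is. *)
Lemma coprime_or_dvd_D P Q : coprimep P Q -> Q != 0 -> size P = (size Q + k.-1)%N ->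
  (size (cf_norm k P Q) <= k.+1)%N -> coprimep Q D \/ D %| Q.
Proof.
move=> cPQ Q0 sP sN; have [c c2 [eQ _]] := flip_convergent cPQ Q0 sP sN.
have [|ncop] := boolP (coprimep Q D); [by left | right].
pose g := gcdp Q D.
have gD : g %| D by apply: dvdp_gcdr.
have g0 : g != 0 by apply: contraNneq (D_neq0 'F_p) => g0; rewrite -dvd0p -g0.
have sg := dvdp_leq (D_neq0 'F_p) gD; rewrite size_D in sg.
move: ncop; rewrite coprimep_def -/g => sg1.
have [sg3|sg3] := eqVneq (size g) 3.
  have : g %= D by rewrite -dvdp_size_eqp // sg3 size_D.
  by case/andP => _ /dvdp_trans; apply; apply: dvdp_gcdl.
(* A common factor of degree 1 has a root a; by symmetry -a is a root of Q too, and a, -a are the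
   two roots of D. *)
have sg2 : size g = 2 by move: sg sg1 sg3 g0; rewrite -size_poly_gt0; case: (size g) => [|[|[|[|]]]].
have [a ra] : exists a, root g a.
  have g1 : g`_1 != 0 by have := g0; rewrite -lead_coef_eq0 lead_coefE sg2.
  exists (- (g`_0 / g`_1)); apply/rootP; rewrite horner_coef sg2 !big_ord_recl big_ord0 /=.
  by rewrite expr0 expr1 mulr1 addr0 mulrN mulrCA divff // mulr1 subrr.
have /andP[rQ rD] : root Q a && root D a by rewrite -root_gcd.
have a2 : a ^+ 2 + 1 = 0 by move/rootP: rD; rewrite !hornerE.
have rQ' : root Q (- a).
  by apply/rootP; rewrite -horner_flip eQ hornerZ (rootP rQ) mulr0.
have DE : D = ('X - a%:P) * ('X - (- a)%:P).
  have -> : 1 = - (a ^+ 2)%:P :> {poly 'F_p}.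
    by rewrite -polyC1 -polyCN; congr polyC; apply/eqP; rewrite -addr_eq0 addrC a2.
  by rewrite polyCN polyC_exp; ring.
rewrite DE Gauss_dvdp; first by rewrite !dvdp_XsubCl rQ rQ'.
rewrite coprimep_XsubC root_XsubC.
apply/eqP => e; have a0 : a = 0.
  apply/eqP; have : a *+ 2 == 0 by rewrite mulr2n {1}(esym e) addNr.
  by rewrite -mulr_natr mulf_eq0 (negPf (two_neq0_Fp hp hodd)) orbF.
by move/eqP: a2; rewrite a0 expr0n add0r oner_eq0.
Qed.

End Parity.

(** * Partial quotients of degree at least 2 for k = 2 p^s *)

Section LargeQuotients.
Variable p : nat.
Hypotheses (hp : prime p) (hodd : odd p).
Implicit Types (P Q : {poly 'F_p}).

Lemma size_XnM n Q : Q != 0 -> size ('X^n * Q) = (n + size Q)%N.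
Proof. by move=> Q0; rewrite mulrC size_mulXn. Qed.

(** If Q is coprime to D, [small_norm] applies to U = t^k Q, V = P. If Q = D R, one factor D leaves
    the norm and it applies to U = P, V = t^k R, whence the norm of degree 2. In both cases m is deg
    U, the exponent of the unit. *)
Lemma large_quotient_convergent s P Q (k := (2 * p ^ s)%N) :
  coprimep P Q -> Q != 0 -> size P = (size Q + k.-1)%N ->
  cf_norm k P Q != 0 -> (size (cf_norm k P Q) <= k)%N ->
  exists2 m, (p ^ s.+1 %| m)%N &
    ((size Q).-1 + k = m /\ size (cf_norm k P Q) = 1)%N \/
    ((size Q).-1 + k = m.+1 /\ size (cf_norm k P Q) = 3)%N.
Proof.
move=> cPQ Q0 sP N0 sN.
have pk : (0 < p ^ s)%N by rewrite expn_gt0 prime_gt0.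
have k0 : (0 < k)%N by rewrite muln_gt0.
have ke : ~~ odd k by rewrite oddM.
have kE : k = (2 * p ^ s)%N by [].
clearbody k.
have P0 : P != 0 by rewrite -size_poly_gt0 sP; move: Q0; rewrite -size_poly_gt0; lia.
have sQ : (0 < size Q)%N by rewrite size_poly_gt0.
have [n sQn] : exists n, size Q = n.+1 by exists (size Q).-1; rewrite prednK.
have oN := odd_size_norm hp hodd ke k0 cPQ Q0 sP (leqW sN) N0.
have [cQD|/dvdpP[R eR]] := coprime_or_dvd_D hp hodd ke k0 cPQ Q0 sP (leqW sN).
  have [] := @small_norm p hp hodd s true Q P.
  - by [].
  - by [].
  - by rewrite coprimep_sym.
  - by [].
  - rewrite /= mul1n mul0n mul0n expr0 mul1r size_XnM // sP -?kE.
    by rewrite -addnS prednK // addnC.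
  - rewrite /= mul1n !mul0n expr0 mul1r exprMn -size_polyN opprB -?kE.
    exact: oN.
  - rewrite /= mul1n !mul0n expr0 mul1r exprMn -size_polyN opprB -?kE.
    exact: sN.
  rewrite /= mul1n !mul0n expr0 mul1r exprMn -size_polyN opprB -?kE => s1 d.
  exists (size ('X^k * Q)).-1 => //; left; split; last exact: s1.
  by rewrite size_XnM // sQn; clear; lia.
have R0 : R != 0 by apply: contraNneq Q0 => R0; rewrite eR R0 mul0r.
have [r sRr] : exists r, size R = r.+1.
  by exists (size R).-1; rewrite prednK // size_poly_gt0.
have cPR : coprimep P R by move: cPQ; rewrite eR coprimepMr => /andP[].
have cPD : coprimep P ('X^2 + 1) by move: cPQ; rewrite eR coprimepMr => /andP[].
have sQR : size Q = r.+3 by rewrite eR size_mul ?D_neq0 // size_D sRr addnC.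
have eN : cf_norm k P Q = ('X^2 + 1) * (P ^+ 2 - ('X^2 + 1) * ('X^k * R) ^+ 2).
  by rewrite /cf_norm eR; ring.
have N10 : P ^+ 2 - ('X^2 + 1) * ('X^k * R) ^+ 2 != 0.
  by apply: contraNneq N0 => h; rewrite eN h mulr0.
have sNN : size (cf_norm k P Q) = (size (P ^+ 2 - ('X^2 + 1) * ('X^k * R) ^+ 2)).+2.
  by rewrite eN size_mul ?D_neq0 // size_D.
have [] := @small_norm p hp hodd s false P R.
- by [].
- by [].
- by [].
- by [].
- rewrite /= mul1n !mul0n expr0 mul1r size_XnM // sP sQR sRr -?kE.
  by move: k0; clear; lia.
- rewrite /= mul1n !mul0n expr0 mul1r -?kE.
  by move: oN; rewrite sNN /= negbK.
- rewrite /= mul1n !mul0n expr0 mul1r -?kE.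
  by move: sN; rewrite sNN => /ltnW/ltnW.
rewrite /= mul1n !mul0n expr0 mul1r -?kE => s1 d.
exists (size P).-1 => //; right; split; last by rewrite sNN s1.
by rewrite sP sQn; move: k0; clear; lia.
Qed.

End LargeQuotients.

(** * Convergents from powers of the unit t + sqrt (t^2 + 1) *)

Section PellApproximations.
Variable p : nat.
Hypotheses (hp : prime p) (hodd : odd p).
Implicit Types (P Q : {poly 'F_p}).

Local Notation D := ('X^2 + 1 : {poly 'F_p}).

(* (t + sqrt D)^r = (pell r).1 + (pell r).2 sqrt D *)
Fixpoint pell r : {poly 'F_p} * {poly 'F_p} :=
  if r is r'.+1 then
    ('X * (pell r').1 + D * (pell r').2, (pell r').1 + 'X * (pell r').2)
  else (1, 0).

Local Notation U r := (pell r).1.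
Local Notation V r := (pell r).2.

Lemma pell_norm r : U r ^+ 2 - D * V r ^+ 2 = (-1) ^+ r.
Proof.
elim: r => [|r IH] /=; first by rewrite expr0n mulr0 subr0 expr1n.
by rewrite [RHS]exprS -IH; ring.
Qed.

Lemma pell_top r : [/\ (size (U r.+1) <= r.+2)%N, (size (V r.+1) <= r.+1)%N,
  (U r.+1)`_r.+1 = 2 ^+ r & (V r.+1)`_r = 2 ^+ r].
Proof.
elim: r => [|r [sU sV cU cV]].
  rewrite /= !mulr0 !addr0 mulr1 size_polyX size_poly1 coefX coef1 expr0.
  by split.
have E : pell r.+2 = ('X * U r.+1 + D * V r.+1, U r.+1 + 'X * V r.+1) by [].
move: (U r.+1) (V r.+1) sU sV cU cV E => u v sU sV cU cV -> /=.
split.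
- rewrite (leq_trans (size_polyD _ _)) // geq_max !(leq_trans (size_polyMleq _ _)) //.
    by rewrite size_D.
  by rewrite size_polyX.
- rewrite (leq_trans (size_polyD _ _)) // geq_max sU (leq_trans (size_polyMleq _ _)) //.
  by rewrite size_polyX.
- rewrite coefD coefXM /= cU mulrDl mul1r coefD coefXnM /= subn2 /= cV.
  by rewrite (nth_default 0 (leq_trans sV (leqnSn _))) addr0 exprS; ring.
by rewrite coefD coefXM /= cU cV exprS; ring.
Qed.

Lemma two_exp_neq0 r : 2 ^+ r != 0 :> 'F_p.
Proof. by rewrite expf_neq0 // two_neq0_Fp. Qed.

Lemma size_pellU r : size (U r.+1) = r.+2.
Proof.
have [sU _ cU _] := pell_top r; apply/eqP; rewrite eqn_leq sU ltnNge.
by apply: contra (two_exp_neq0 r) => h; rewrite -cU nth_default.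
Qed.

Lemma size_pellV r : size (V r.+1) = r.+1.
Proof.
have [_ sV _ cV] := pell_top r; apply/eqP; rewrite eqn_leq sV ltnNge.
by apply: contra (two_exp_neq0 r) => h; rewrite -cV nth_default.
Qed.

Lemma lead_pell r : lead_coef (U r.+1) = lead_coef (V r.+1).
Proof.
have [_ _ cU cV] := pell_top r.
by rewrite !lead_coefE size_pellU size_pellV cU cV.
Qed.

(** For odd r the variable t divides U, for even r it divides V; the linear coefficient r shows that
    it does so only once when p does not divide r. *)
Lemma pell_bottom r : [/\ (U r)`_0 = (~~ odd r)%:R, (V r)`_0 = (odd r)%:R,
  (U r)`_1 = (odd r * r)%:R & (V r)`_1 = (~~ odd r * r)%:R].
Proof.
elim: r => [|r [u0 v0 u1 v1]] /=; first by rewrite !coef1 !coef0.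
rewrite !coefD !coefXM /= mulrDl mul1r !coefD !coefXnM /= u0 v0 u1 v1 !add0r negbK.
by split=> //; case: (odd r); rewrite ?mul0n ?mul1n ?addr0 // -natr1 addrC.
Qed.

Lemma factor_X Q : Q`_0 = 0 -> exists2 W, Q = 'X * W & W`_0 = Q`_1.
Proof.
move=> q0; have /dvdpP[W eW] : 'X %| Q.
  by rewrite -['X]subr0 -polyC0 dvdp_XsubCl; apply/rootP; rewrite horner_coef0.
by exists W; rewrite eW; [rewrite mulrC | rewrite coefMX].
Qed.

Lemma expp_sub s (x y : {poly 'F_p}) : (x - y) ^+ (p ^ s) = x ^+ (p ^ s) - y ^+ (p ^ s).
Proof.
elim: s => [|s IH]; first by rewrite expn0 !expr1.
by rewrite expnSr !exprM IH -!(pFrobenius_autE (pchar_polyFp hp)) rmorphB.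
Qed.

(** With q = 2 h + 1, the q-th power of the unit's r-th power has components U^q and D^h V^q. The
    one divisible by t^q must supply t^k Q. For odd r it is the first. For even r it is the second,
    and then Q also takes a factor D, which accounts for the terms in [~~ odd r]. If k > q, P takes
    the missing t^(k-q), which stays coprime to Q because p does not divide r. *)
Lemma pell_convergent s r k (q := (p ^ s)%N) (a := minn k q) :
  (0 < r)%N -> (0 < k)%N -> (k <= q)%N || ~~ (p %| r)%N ->
  exists P Q, [/\ coprimep P Q, Q != 0, size P = (size Q + k.-1)%N,
    lead_coef P = lead_coef Q &
    (size Q + a = (q * r + ~~ odd r).+1)%N /\
    (size (cf_norm k P Q) = (2 * (k - a)).+1 + 2 * ~~ odd r)%N].
Proof.
move=> r0 k0 hr; have q0 : (0 < q)%N by rewrite expn_gt0 prime_gt0.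
have leak : (a <= k)%N by rewrite geq_minl.
have leaq : (a <= q)%N by rewrite geq_minr.
have [h qh] : exists h, q = h.*2.+1.
  by exists q./2; rewrite -{1}(odd_double_half q) /q oddX hodd orbT.
case: r r0 hr => [//|r] _ hr.
(* i is the excess of k over q and j that of q over k, so one of them is 0. *)
have [i ki] : exists i, k = (a + i)%N by exists (k - a)%N; rewrite subnKC.
have [j qj] : exists j, q = (a + j)%N by exists (q - a)%N; rewrite subnKC.
have ika : (k - a)%N = i by rewrite {1}ki addKn.
have hij : (0 < i)%N -> j = 0 /\ ~~ (p %| r.+1)%N.
  move=> i0; have nkq : ~~ (k <= q)%N.
    by apply/negP => leqk; move: ki; rewrite /a (minn_idPl leqk); lia.
  rewrite (negPf nkq) in hr; split=> //.
  by move: qj; rewrite /a (minn_idPr _) 1?ltnW ?ltnNge //; lia.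
have Xk : 'X^k = 'X^a * 'X^i :> {poly 'F_p} by rewrite {1}ki exprD.
have Xq : 'X^q = 'X^a * 'X^j :> {poly 'F_p} by rewrite {1}qj exprD.
have Dq : D * (D ^+ h) ^+ 2 = D ^+ q by rewrite -exprM muln2 -exprS -qh.
have sDh n : size (D ^+ n) = (2 * n).+1 by rewrite size_exp_neq0 ?D_neq0 // size_D.
have nz n (Q : {poly 'F_p}) : Q != 0 -> Q ^+ n != 0 by exact: expf_neq0.
have X0 n : 'X^n != 0 :> {poly 'F_p} by rewrite expf_neq0 // polyX_eq0.
have D0 := D_neq0 'F_p.
have U0 : U r.+1 != 0 by rewrite -size_poly_gt0 size_pellU.
have V0 : V r.+1 != 0 by rewrite -size_poly_gt0 size_pellV.
have [bU bV bU1 bV1] := pell_bottom r.+1.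
have norm_q : (D * V r.+1 ^+ 2) ^+ q - (U r.+1 ^+ 2) ^+ q = (- (-1) ^+ r.+1) ^+ q.
  by rewrite -expp_sub -pell_norm opprB.
have oq : odd q by rewrite qh /= odd_double.
clearbody a q.
have [or|er] := boolP (odd r.+1).
  have [W eW W0] : exists2 W, U r.+1 = 'X * W & W`_0 = r.+1%:R.
    have [|W eW W0] := @factor_X (U r.+1); first by rewrite bU or.
    by exists W; rewrite // W0 bU1 or mul1n.
  have Wn0 : W != 0 by apply: contraNneq U0 => W00; rewrite eW W00 mulr0.
  have sW : size W = r.+1.
    by have := size_pellU r; rewrite eW mulrC size_mulX // => -[].
  have lW : lead_coef W = lead_coef (V r.+1).
    by rewrite -lead_pell eW lead_coefM lead_coefX mul1r.
  pose v := V r.+1 ^+ q * D ^+ h; pose w := 'X^j * W ^+ q.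
  have nvw : D * v ^+ 2 - ('X^a * w) ^+ 2 = 1.
    have -> : 'X^a * w = U r.+1 ^+ q by rewrite /w mulrA -Xq eW exprMn.
    have -> : D * v ^+ 2 = (D * V r.+1 ^+ 2) ^+ q.
      by rewrite [v ^+ 2]exprMn mulrCA Dq mulrC (exprMn q D) [in RHS]exprAC.
    by rewrite -[_ ^+ q ^+ 2]exprAC norm_q -signr_odd or expr1 opprK expr1n.
  exists ('X^i * v), w.
  have sv : size v = (r * q + 2 * h).+1.
    by rewrite size_mul ?nz // sDh size_exp_neq0 // size_pellV; clear; lia.
  have sw : size w = (j + r * q).+1.
    by rewrite size_XnM ?nz // size_exp_neq0 // sW addnS.
  have v0 : v != 0 by rewrite -size_poly_gt0 sv.
  have w0 : w != 0 by rewrite -size_poly_gt0 sw.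
  split=> //.
  - rewrite coprimepMl; apply/andP; split.
      have [->|i0] := posnP i; first by rewrite expr0 coprime1p.
      have [j0 pr] := hij i0.
      rewrite coprimep_expl // coprimep_sym coprimepX rootE horner_coef0 /w j0 expr0 mul1r.
      by rewrite -horner_coef0 horner_exp horner_coef0 W0 expf_neq0 // -(dvdn_pcharf (pchar_Fp hp)).
    apply/Bezout_coprimepP; exists (D * v, - ('X^a ^+ 2 * w)).
    by apply/eqpP; exists (1, 1); rewrite ?oner_eq0 //= !scale1r -[RHS]nvw; ring.
  - by rewrite size_XnM // sv sw; move: k0 ki qj qh; clear; lia.
  - by rewrite !lead_coefM !lead_coef_exp !lead_coefX lW lead_D !expr1n !mul1r mulr1.
  rewrite sw /=; split; first by move: qj; rewrite mulnS mulnC; clear; lia.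
  have -> : cf_norm k ('X^i * v) w = 'X^(2 * i).
    transitivity ('X^i ^+ 2 * (D * v ^+ 2 - ('X^a * w) ^+ 2)).
      by rewrite /cf_norm Xk; ring.
    by rewrite nvw mulr1 -exprM mulnC.
  by rewrite size_polyXn ika addn0.
have [W eW W0] : exists2 W, V r.+1 = 'X * W & W`_0 = r.+1%:R.
  have [|W eW W0] := @factor_X (V r.+1); first by rewrite bV (negPf er).
  by exists W; rewrite // W0 bV1 er mul1n.
have Wn0 : W != 0 by apply: contraNneq V0 => W00; rewrite eW W00 mulr0.
have sW : r = size W.
  by have := size_pellV r; rewrite eW mulrC size_mulX // => -[].
have [m sWm] : exists m, size W = m.+1.
  by exists (size W).-1; rewrite prednK // size_poly_gt0.
have lW : lead_coef W = lead_coef (U r.+1).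
  by rewrite lead_pell eW lead_coefM lead_coefX mul1r.
pose u := U r.+1 ^+ q; pose w := D ^+ h * W ^+ q.
have nuw : u ^+ 2 - D * ('X^a * ('X^j * w)) ^+ 2 = 1.
  have -> : 'X^a * ('X^j * w) = D ^+ h * V r.+1 ^+ q.
    by rewrite mulrA -Xq eW exprMn /w mulrCA.
  have -> : D * (D ^+ h * V r.+1 ^+ q) ^+ 2 = (D * V r.+1 ^+ 2) ^+ q.
    by rewrite [(D ^+ h * _) ^+ 2]exprMn mulrA Dq (exprMn q D) [in RHS]exprAC.
  rewrite /u [_ ^+ q ^+ 2]exprAC -[LHS]opprB norm_q -signr_odd (negPf er) expr0.
  by rewrite -signr_odd oq expr1 opprK.
exists ('X^i * u), ('X^j * (D * w)).
have su : size u = (r.+1 * q).+1 by rewrite size_exp_neq0 // size_pellU.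
have sw : size (D * w) = (m * q + 2 * h).+3.
  have w0 : w != 0 by rewrite mulf_neq0 // nz.
  by rewrite size_mul // size_D size_mul ?nz // sDh size_exp_neq0 // sWm /=; clear; lia.
have u0 : u != 0 by rewrite -size_poly_gt0 su.
have w0 : D * w != 0 by rewrite -size_poly_gt0 sw.
have rq : (r.+1 * q = m * q + q + q)%N by rewrite sW sWm !mulSn; clear; lia.
split.
- rewrite coprimepMl; apply/andP; split.
    have [->|i0] := posnP i; first by rewrite expr0 coprime1p.
    have [j0 pr] := hij i0.
    rewrite coprimep_expl // coprimep_sym coprimepX rootE j0 expr0 mul1r.
    have D1 : D.[0] = 1 by rewrite !hornerE expr0n add0r.
    rewrite /w !hornerM !horner_exp D1 (horner_coef0 W) W0 expr1n !mul1r.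
    by rewrite expf_neq0 // -(dvdn_pcharf (pchar_Fp hp)).
  apply/Bezout_coprimepP; exists (u, - ('X^a ^+ 2 * ('X^j * w))).
  by apply/eqpP; exists (1, 1); rewrite ?oner_eq0 //= !scale1r -[RHS]nuw; ring.
- by rewrite mulf_neq0.
- by rewrite !size_XnM // su sw rq; move: k0 ki qj qh; clear; lia.
- by rewrite !lead_coefM !lead_coef_exp !lead_coefX lW lead_D !expr1n !mul1r.
rewrite size_XnM // sw /=; split.
  by rewrite [(q * _)%N]mulnC rq; move: qj qh; clear; lia.
have -> : cf_norm k ('X^i * u) ('X^j * (D * w)) = 'X^(2 * i) * D.
  transitivity ('X^i ^+ 2 * D * (u ^+ 2 - D * ('X^a * ('X^j * w)) ^+ 2)).
    by rewrite /cf_norm Xk; ring.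
  by rewrite nuw mulr1 -exprM mulnC.
by rewrite size_XnM // size_D ika; clear; lia.
Qed.

End PellApproximations.

(** * Counting gaps *)

Section Counting.
Variable d : nat -> nat.
Hypothesis d_lt : forall i, (d i < d i.+1)%N.
Implicit Types (i j k n m u M T : nat).

Let gap i := (d i.+1 - d i)%N.

Lemma gap_sum_mono i j : (i < j)%N -> (d i + d i.+1 < d j + d j.+1)%N.
Proof.
elim: j => // j IH; rewrite ltnS leq_eqVlt => /orP[/eqP ->|/IH].
  by have := d_lt j; have := d_lt j.+1; lia.
by have := d_lt j; have := d_lt j.+1; lia.
Qed.

(* A gap is identified by its centre: [c u] is twice the centre of the u-th prescribed gap. *)
Lemma centred_gaps_ge (c g : nat -> nat) n :
  (forall u, (c u < c u.+1)%N) ->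
  (forall u, (0 < u)%N -> (0 < g u)%N ->
     exists2 i, (d i + d i.+1 = c u)%N & (g u <= gap i)%N) ->
  forall m M, (forall u i, (u <= m)%N -> (d i + d i.+1 = c u)%N -> (i < M)%N) ->
  (\sum_(u < m) (g u.+1 - n) <= \sum_(i < M) (gap i - n))%N.
Proof.
move=> c_lt hg; elim=> [|m IH] M hM; first by rewrite big_ord0.
rewrite big_ord_recr /=.
have c_mono u v : (u < v)%N -> (c u < c v)%N.
  elim: v => // v IHv; rewrite ltnS leq_eqVlt => /orP[/eqP -> //|/IHv h].
  exact: ltn_trans h (c_lt v).
have [g0|g0] := posnP (g m.+1).
  by rewrite g0 sub0n addn0; apply: IH => u i lu; apply: hM; apply: leqW.
have [i ci gi] := hg m.+1 (ltn0Sn m) g0.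
have ltiM : (i < M)%N by apply: hM ci.
apply: (@leq_trans (\sum_(j < i.+1) (gap j - n))).
  rewrite big_ord_recr /= leq_add //; last by rewrite leq_sub2r.
  apply: IH => u j leu cj; rewrite ltnNge leq_eqVlt; apply/negP => /orP[/eqP eij|/gap_sum_mono].
    by move: ci; rewrite eij cj => e; have := c_mono u m.+1 leu; rewrite e ltnn.
  by rewrite ci cj => h; have := c_mono u m.+1 leu; rewrite ltnNge ltnW.
rewrite (big_ord_widen M (fun j => (gap j - n)%N)) // big_mkcond /=.
by apply: leq_sum => j _; case: ifP.
Qed.

(** Distinct gaps have distinct centres, so at most m gaps exceed 1, each contributing at most k. *)
Lemma centred_gaps_le (c : nat -> nat) k :
  (forall u v, (u <= v)%N -> (c u <= c v)%N) ->
  (forall i, (1 < gap i)%N -> exists2 u, (d i + d i.+1 = c u.+1)%N & (gap i <= k.+1)%N) ->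
  forall M m, (forall i u, (i < M)%N -> (d i + d i.+1 = c u.+1)%N -> (u < m)%N) ->
  (\sum_(i < M) (gap i - 1) <= k * m)%N.
Proof.
move=> c_le hg; elim=> [|M IH] m hm; first by rewrite big_ord0.
rewrite big_ord_recr /=; have [g1|g1] := leqP (gap M) 1.
  have -> : (gap M - 1 = 0)%N by apply/eqP; rewrite subn_eq0.
  by rewrite addn0; apply: IH => i u ltiM; apply: hm; apply: leqW.
have [u cu gk] := hg M g1.
have ltum : (u < m)%N by apply: hm cu.
apply: (@leq_trans (k * u + k)); last by rewrite -mulnSr leq_mul2l ltum orbT.
rewrite leq_add //; last by rewrite leq_subLR add1n.
apply: IH => i v ltiM cv; rewrite ltnNge; apply/negP => leuv.
by have := gap_sum_mono ltiM; rewrite cv cu ltnNge c_le.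
Qed.

End Counting.

(** In a block of p exponents the multiple of p gives k, and the others, at least one, give 2 q - k
    or more in total; the sum is at least 2 q, less n + 1 for each exponent. Truncated subtraction
    covers k >= 2 q. *)
Lemma block_sum_ge (p q k n T : nat) (g : nat -> nat) : (1 < p)%N -> (q < k)%N ->
  (forall u, (p %| u)%N -> g u = (k - 1)%N) ->
  (forall u, ~~ (p %| u)%N -> g u = (2 * q - k - 1)%N) ->
  (2 * q * T <= \sum_(u < p * T) (g u.+1 - n) + p * n.+1 * T)%N.
Proof.
case: p => // p' p1 qk gp gnp; elim: T => [|T IH]; first by rewrite !muln0.
rewrite (mulnSr (2 * q)) (mulnSr p'.+1 T) (mulnSr (p'.+1 * n.+1)) big_split_ord /=.
rewrite addnACA leq_add //.
have -> : (\sum_(i < p'.+1) (g (p'.+1 * T + i).+1 - n) =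
    p' * (2 * q - k - 1 - n) + (k - 1 - n))%N.
  rewrite big_ord_recr /= gp; last by rewrite -addnS -mulnSr dvdn_mulr.
  congr (_ + _)%N; rewrite (eq_bigr (fun=> (2 * q - k - 1 - n)%N)).
    by rewrite sum_nat_const card_ord.
  move=> i _; rewrite gnp // -addnS dvdn_addr ?dvdn_mulr //.
  by rewrite gtnNdvd // ltnS.
have : (2 * q - k <= p' * (2 * q - k - 1 - n) + p' * n.+1)%N.
  rewrite -mulnDr; apply: (@leq_trans (2 * q - k - 1 - n + n.+1)); first by lia.
  by rewrite leq_pmull.
by rewrite (mulSn p'); move: (p' * _)%N (p' * _)%N; lia.
Qed.

(** * Averages of eventually periodic sequences *)

Section Averages.
Variable R : realType.

(* If the period sum were negative, the partial sums would tend to -oo. *)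
Lemma periodic_sum_ge0 (f : nat -> R) (N l : nat) (C : R) : (0 < l)%N ->
  (forall i, (N <= i)%N -> f (i + l)%N = f i) ->
  (forall T, exists2 M, (T <= M)%N & - C <= \sum_(i < M) f i) ->
  0 <= \sum_(N <= i < N + l) f i.
Proof.
move=> l0 per h; set s := \sum_(N <= i < N + l) f i.
pose F M := \sum_(0 <= i < M) f i.
have window r : \sum_(N + r <= i < N + r + l) f i = s.
  elim: r => [|r IH]; first by rewrite addn0.
  have lt1 : (N + r < N + r + l)%N by rewrite -{1}[(N + r)%N]addn0 ltn_add2l.
  rewrite addnS addSn big_nat_recr //= per ?leq_addr // -IH [in RHS]big_ltn // addrC.
  by [].
have step r : F (N + r + l)%N = F (N + r)%N + s.
  by rewrite /F (@big_cat_nat _ _ _ (N + r)) //= ?window // leq_addr.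
have steps r j : F (N + r + j * l)%N = F (N + r)%N + s *+ j.
  elim: j => [|j IH]; first by rewrite mul0n addn0 mulr0n addr0.
  have -> : (N + r + j.+1 * l = N + (r + j * l) + l)%N.
    by rewrite mulSn addnCA addnC addnA.
  by rewrite step addnA IH mulrSr addrA.
rewrite leNgt; apply/negP => s0.
pose B := \sum_(0 <= i < N + l) `|f i|.
have FB r : (r < l)%N -> F (N + r)%N <= B.
  move=> rl; apply: (@le_trans _ _ (\sum_(0 <= i < N + r) `|f i|)).
    by apply: ler_sum => i _; apply: ler_norm.
  have rl' : (N + r <= N + l)%N by rewrite leq_add2l ltnW.
  rewrite /B (@big_cat_nat _ _ _ (N + r) 0 (N + l)) //=.
  by apply: ler_wpDr => //; apply: sumr_ge0.
have [J hJ] : exists J : nat, B + C < J%:R * - s.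
  exists (Num.truncn (`|B + C| / - s)).+1.
  rewrite -ltr_pdivrMr ?oppr_gt0 //; apply: le_lt_trans (truncnS_gt _).
  by rewrite ler_pM2r ?invr_gt0 ?oppr_gt0 // ler_norm.
have [M leM] := h (N + J * l)%N; rewrite -(big_mkord xpredT f) -/(F M).
have leNM : (N <= M)%N by apply: leq_trans leM; apply: leq_addr.
have ME : M = (N + (M - N) %% l + (M - N) %/ l * l)%N.
  by rewrite -addnA [(_ %% _ + _)%N]addnC -divn_eq subnKC.
rewrite ME steps => hM.
have leJ : (J <= (M - N) %/ l)%N by rewrite leq_divRL // -(leq_add2l N) subnKC.
have h1 := FB _ (ltn_pmod (M - N) l0).
have h2 : s *+ ((M - N) %/ l) <= s *+ J.
  by rewrite -(mulr_natr s J) -(mulr_natr s ((M - N) %/ l)) ler_nM2l // ler_nat.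
have h3 : s *+ J < - (B + C) by rewrite ltrNr -mulNrn -(mulr_natl (- s) J).
have : - C < B + - (B + C).
  apply: le_lt_trans hM _; apply: le_lt_trans (lerD h1 h2) _.
  by rewrite ltrD2l.
by rewrite opprD addrA subrr add0r ltxx.
Qed.

End Averages.

(** * Sums of partial quotients *)

Section Expansions.
Variable p : nat.
Hypotheses (hp : prime p) (hodd : odd p).

Local Notation D := ('X^2 + 1 : {poly 'F_p}).
Local Notation scaled k := (lmul (Theta_p p) (lser_of_poly ('X ^+ k))).

Let p_gt0 : (0 < p)%N := prime_gt0 hp.
Let two_neq0 := two_neq0_Fp hp hodd.

Lemma lc_Theta : lc (phi (Theta_p p)) (-1) 1.
Proof. by exists (cantor_ps p) => //; exact: cantor_seq0. Qed.

Lemma lc_scaled k : lc (phi (scaled k)) (k%:Z - 1) 1.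
Proof.
rewrite phi_mul phi_poly; have := lcM lc_Theta (lc_embed ('X^k : {poly 'F_p})).
by rewrite size_polyXn lead_coefXn mulr1; have -> : -1 + (k.+1%:Z - 1) = k%:Z - 1 by lia.
Qed.

Lemma scaled_sqr k : phi (scaled k) ^+ 2 * embed D = embed ('X^k ^+ 2).
Proof.
rewrite phi_mul phi_poly exprMn mulrAC phi_Theta_sqr // mul1r.
by rewrite -(rmorphXn _ 2).
Qed.

Lemma chain_of_expansion (x : lser 'F_p) (A : nat -> {poly 'F_p}) : is_cf_expansion x A ->
  exists2 X, cf_chain (phi x) X & forall i, A i = lpolypart (X i).
Proof.
move=> [X [/lser_eqP X0 [XA Xi]]]; exists X => //; split=> // i.
by have /lser_eqP := Xi i; rewrite phi_mul phi_one.
Qed.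

(** Pigeonhole: the states (B, C) have bounded degree over a finite field, and a repeated state
    repeats all later complete quotients. *)
Lemma expansion_periodic k : (0 < k)%N ->
  exists A N l, is_cf_expansion (scaled k) A /\ periodic_from A N l.
Proof.
move=> k0.
have [X [X0 [_ chainX] st]] := cf_chain_exists two_neq0 k0 (scaled_sqr k) (lc_scaled k) erefl.
have /choice[bc hbc] : forall i, exists bc : {poly 'F_p} * {poly 'F_p},
    cf_state k (phi (scaled k)) (X i) bc.1 bc.2.
  by move=> i; have [B [C h]] := st i; exists (B, C).
pose T := ('rV['F_p]_k.+2 * 'rV['F_p]_k.+2)%type.
pose code (i : 'I_#|{: T}|.+1) : T := (poly_rV (bc i).1, poly_rV (bc i).2).
have [i [j ltij eij]] : exists i, exists2 j, (i < j)%N & phi (X i) = phi (X j).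
  have /injectivePn[i [j neij ecode]] : ~~ injectiveb code.
    apply/negP => /injectiveP/leq_card; by rewrite card_ord ltnn.
  have eX : phi (X i) = phi (X j).
    have [Ci0 Xi _ sCi sBi] := hbc i; have [Cj0 Xj _ sCj sBj] := hbc j.
    have eB : (bc i).1 = (bc j).1.
      by rewrite -(poly_rV_K sBi) -(poly_rV_K sBj); case: ecode => -> _.
    have eC : (bc i).2 = (bc j).2.
      by rewrite -(poly_rV_K sCi) -(poly_rV_K sCj); case: ecode => _ ->.
    have iC0 : embed (bc j).2 != 0 by rewrite embed_eq0.
    by apply: (mulIf iC0); rewrite Xj -eC Xi eB.
  have [lt|le] := ltnP i j; first by exists i, j.
  exists j, i => //; rewrite ltn_neqAle le andbT.
  by apply: contraNneq neij => e; apply/eqP/val_inj.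
have shift m : phi (X (i + m)%N) = phi (X (j + m)%N).
  elim: m => [|m IH]; first by rewrite !addn0.
  rewrite !addnS; have := chainX (i + m)%N; have := chainX (j + m)%N.
  rewrite (phi_lfrac_congr IH) => e1 e2.
  have f0 : phi (lfrac (X (j + m)%N)) != 0.
    by apply/eqP => f0; move/eqP: e1; rewrite f0 mulr0 eq_sym oner_eq0.
  by apply: (mulIf f0); rewrite e1 e2.
exists (fun n => lpolypart (X n)), i, (j - i)%N; split.
  exists X; split; first by rewrite X0.
  split=> // n; apply/lser_eqP; by rewrite phi_mul phi_one.
split; first by rewrite subn_gt0.
move=> n len; apply: lpolypart_congr; rewrite -(subnKC len) shift.
by congr (phi (X _)); lia.
Qed.

Lemma period_data_exists k : (0 < k)%N -> exists A N l, cf_period_data (scaled k) A N l.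
Proof.
move=> /expansion_periodic[A [N [l [expA perA]]]].
have ex : exists l, `[< exists N, periodic_from A N l >].
  by exists l; apply/asboolP; exists N.
have [l' /asboolP[N' per'] minl] := ex_minnP ex.
exists A, N', l'; split=> //; split=> // N2 l2 per2; apply: minl.
by apply/asboolP; exists N2.
Qed.

Section Degrees.
Variables (k : nat) (X : nat -> lser 'F_p).
Hypotheses (k_gt0 : (0 < k)%N) (chainX : cf_chain (phi (scaled k)) X).
Local Notation d := (cf_deg X).

Lemma cf_gap_convergent i : exists P Q : {poly 'F_p}, [/\ coprimep P Q, size Q = (d i).+1,
  size P = (d i + k)%N, cf_norm k P Q != 0 &
  (size (cf_norm k P Q) + d i.+1 = k.+2 + d i)%N].
Proof.
have [P [Q [cPQ sQ sP sN]]] :=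
  convergent_norm two_neq0 k_gt0 (scaled_sqr k) (lc_scaled k) chainX i.
exists P, Q; split=> //; rewrite subr_eq0 -exprMn; apply/eqP => /esym/(D_nonsquare two_neq0) P0.
by move: sP k_gt0; rewrite P0 size_poly0; lia.
Qed.

Lemma cf_gap_le i : (d i.+1 <= d i + k.+1)%N.
Proof.
have [P [Q [_ _ _ N0 sN]]] := cf_gap_convergent i.
by move: N0 sN; rewrite -size_poly_gt0; move: (size _); lia.
Qed.

Lemma cf_deg_le M : (d M <= k.+1 * M)%N.
Proof.
elim: M => [|M IH]; first by rewrite /cf_deg big_ord0.
by rewrite mulnS addnC (leq_trans (cf_gap_le M)) // leq_add2r.
Qed.

(* The gaps coming from the m-th power of t + sqrt D are all centred at m - (k - 1) / 2, whatever the
   parity of m and the power of p dividing it. *)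
Lemma pell_gap s r (a := minn k (p ^ s)) : (0 < r)%N -> (k <= p ^ s)%N || ~~ (p %| r)%N ->
  (k.+2 <= 2 * a)%N -> exists i,
  [/\ (d i + d i.+1 + k = 2 * (p ^ s * r) + 1)%N, (2 * a - k - 1 <= d i.+1 - d i)%N &
      (d i.+1 <= p ^ s * r + 1)%N].
Proof.
move=> r0 hr ha; have [P [Q [cPQ Q0 sP leadPQ [sQ sN]]]] := pell_convergent hp hodd r0 k_gt0 hr.
rewrite -/a in sQ sN; have leak : (a <= k)%N by rewrite geq_minl.
have N0 : cf_norm k P Q != 0 by rewrite -size_poly_gt0 sN.
(* The threshold k + 2 <= 2 a is what keeps deg N, which is 2 (k - a) or 2 more, at most k. *)
have sNk : (size (cf_norm k P Q) <= k.+1)%N.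
  by rewrite sN; move: leak ha; clearbody a; case: (odd r) => /=; lia.
have [i sQi sNi] := norm_convergent two_neq0 k_gt0 (scaled_sqr k) (lc_scaled k) chainX
  cPQ Q0 sP leadPQ N0 sNk.
exists i; move: leak ha sQ sNi; rewrite sN sQi; clearbody a; clear.
move: (p ^ s * r)%N (d i) (d i.+1); case: (odd r) => /= x y z; split; lia.
Qed.

Lemma centred_mono q : (0 < q)%N -> forall u,
  (2 * (q * u) + 1 + k < 2 * (q * u.+1) + 1 + k)%N.
Proof. by move=> q0 u; rewrite mulnS; lia. Qed.

Lemma gap_sum_ge s n T : (p ^ s < k <= p ^ s.+1)%N -> (0 < T)%N -> exists M,
  [/\ (2 * p ^ s * T <= \sum_(i < M) (d i.+1 - d i - n) + p * n.+1 * T)%N,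
      (d M <= p ^ s * (p * T) + 1)%N & (T <= k.+1 * M + k)%N].
Proof.
set q := (p ^ s)%N; have q0 : (0 < q)%N by rewrite expn_gt0 p_gt0.
have qS : (p ^ s.+1 = q * p)%N by rewrite expnSr.
rewrite qS => /andP[qk kq] T0; have k2 : (1 < k)%N by apply: leq_ltn_trans qk.
(* The bound 2 a - k - 1 of [pell_gap], with a = k at level s + 1 and a = q at level s. Truncation
   gives 0 when the threshold of [pell_gap] fails, so nothing is claimed there. *)
pose g u := if (p %| u)%N then (k - 1)%N else (2 * q - k - 1)%N.
have gaps u : (0 < u)%N -> (0 < g u)%N -> exists i,
  [/\ (d i + d i.+1 + k = 2 * (q * u) + 1)%N, (g u <= d i.+1 - d i)%N &
      (d i.+1 <= q * u + 1)%N].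
  rewrite /g => u0; case: ifP => [/dvdnP[r er]|npu] gu.
    have r0 : (0 < r)%N by move: u0; rewrite er; case: r {er}.
    have mk : minn k (p ^ s.+1) = k by apply/minn_idPl; rewrite qS.
    have [||i [h1 h2 h3]] := @pell_gap s.+1 r r0; first by rewrite qS kq.
      by rewrite mk; move: k2; clear; lia.
    have eqr : (p ^ s.+1 * r = q * u)%N by rewrite qS er mulnAC -mulnA.
    exists i; rewrite eqr in h1 h3; rewrite mk in h2; split=> //.
    by apply: leq_trans h2; clear; lia.
  have mq : minn k (p ^ s) = q by apply/minn_idPr; apply: ltnW.
  have [||i [h1 h2 h3]] := @pell_gap s u u0; first by rewrite npu orbT.
    by rewrite mq; move: gu; clear; lia.
  by exists i; rewrite mq in h2.
have pT0 : (0 < p * T)%N by rewrite muln_gt0 p_gt0.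
have [|i0 [e0 _ b0]] := gaps (p * T)%N pT0; first by rewrite /g dvdn_mulr // subn_gt0.
(* The doubled centres are 2 q u + 1 - k; the shift by k avoids truncated subtraction. *)
pose d' i := (d i + k)%N.
have d'_lt i : (d' i < d' i.+1)%N by rewrite ltn_add2r (cf_deg_lt chainX).
have gap' i : (d' i.+1 - d' i = d i.+1 - d i)%N by rewrite subnDr.
(* The prefix ends with the gap of the last exponent q p T, so it contains all gaps with u <= p
   T. *)
exists i0.+1; split=> //; last first.
  have h1 := cf_deg_le i0.+1; have h2 := cf_deg_lt chainX i0.
  have h3 : (T <= q * (p * T))%N by rewrite mulnA leq_pmull // muln_gt0 q0.
  by move: h1 h2 h3 e0; move: (k.+1 * _)%N (q * _)%N; clear; lia.
have p1 := prime_gt1 hp.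
have gp u : (p %| u)%N -> g u = (k - 1)%N by rewrite /g => ->.
have gnp u : ~~ (p %| u)%N -> g u = (2 * q - k - 1)%N by rewrite /g => /negPf ->.
apply: leq_trans (block_sum_ge n T p1 qk gp gnp) _; rewrite leq_add2r.
have hg u : (0 < u)%N -> (0 < g u)%N ->
    exists2 i, (d' i + d' i.+1 = 2 * (q * u) + 1 + k)%N & (g u <= d' i.+1 - d' i)%N.
  move=> u0 /(gaps u u0)[i [h1 h2 _]]; exists i; last by rewrite gap'.
  by rewrite -h1 /d'; clear; lia.
have hM u i : (u <= p * T)%N -> (d' i + d' i.+1 = 2 * (q * u) + 1 + k)%N -> (i < i0.+1)%N.
  move=> leu ei; rewrite ltnS leqNgt; apply/negP => /(gap_sum_mono d'_lt); rewrite ei.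
  have : (q * u <= q * (p * T))%N by rewrite leq_mul2l leu orbT.
  by rewrite /d'; move: e0; move: (q * u)%N (q * _)%N; clear; lia.
have := centred_gaps_ge d'_lt n (centred_mono q0) hg hM.
by under [X in (_ <= X)%N -> _]eq_bigr do rewrite gap'.
Qed.

(** Gaps longer than 1 are centred at multiples of p^(s+1), of which at most (d M + k) / p^(s+1) are
    in range, and each contributes at most k = 2 p^s. *)
Lemma gap_sum_le s n M : k = (2 * p ^ s)%N -> (0 < n)%N ->
  (p * \sum_(i < M) (d i.+1 - d i - n) <= 2 * (d M + k))%N.
Proof.
move=> ks n0; set q := (p ^ s.+1)%N.
have q0 : (0 < q)%N by rewrite expn_gt0 p_gt0.
pose d' i := (d i + k)%N.
have d'_lt i : (d' i < d' i.+1)%N by rewrite ltn_add2r (cf_deg_lt chainX).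
have gap' i : (d' i.+1 - d' i = d i.+1 - d i)%N by rewrite subnDr.
have c_le u v : (u <= v)%N -> (2 * (q * u) + 1 + k <= 2 * (q * v) + 1 + k)%N.
  by move=> leuv; rewrite !leq_add2r !leq_mul2l leuv orbT.
have hg i : (1 < d' i.+1 - d' i)%N ->
    exists2 u, (d' i + d' i.+1 = 2 * (q * u.+1) + 1 + k)%N & (d' i.+1 - d' i <= k.+1)%N.
  rewrite gap' => gap1; have gk := cf_gap_le i.
  suff [u eu] : exists u, (d' i + d' i.+1 = 2 * (q * u.+1) + 1 + k)%N.
    by exists u => //; rewrite leq_subLR.
  have [P [Q [cPQ sQ sP N0 sN]]] := cf_gap_convergent i.
  have Q0 : Q != 0 by rewrite -size_poly_gt0 sQ.
  have sPQ : size P = (size Q + k.-1)%N by rewrite sP sQ; move: k_gt0; clear; lia.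
  have sNk : (size (cf_norm k P Q) <= k)%N.
    by move: sN gap1; move: (size _); clear; lia.
  rewrite ks in cPQ sPQ N0 sNk sN.
  have [m /dvdnP[v ev] hm] := large_quotient_convergent hp hodd cPQ Q0 sPQ N0 sNk.
  rewrite -ks sQ /= in hm sN; rewrite -/q in ev.
  have m0 : (0 < m)%N.
    have ps0 : (0 < p ^ s)%N by rewrite expn_gt0 p_gt0.
    have : (1 < k)%N by rewrite ks; move: ps0; clear; lia.
    by case: hm => -[h1 _]; move: h1; clear; lia.
  case: v ev => [|v] ev; first by move: m0; rewrite ev mul0n.
  exists v; rewrite (mulnC q) -ev /d'; case: hm => -[h1 h2]; rewrite h2 in sN;
  by move: sN h1; clear; lia.
have hM i u : (i < M)%N -> (d' i + d' i.+1 = 2 * (q * u.+1) + 1 + k)%N ->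
    (u < (d M + k) %/ q)%N.
  move=> ltiM e; rewrite leq_divRL // mulnC.
  have leM : (d i.+1 <= d M)%N.
    elim: (M) ltiM => // M' IH; rewrite ltnS leq_eqVlt => /orP[/eqP -> //|/IH h].
    by apply: leq_trans h _; apply: ltnW; exact: (cf_deg_lt chainX).
  have := cf_deg_lt chainX i; move: e leM; rewrite /d'; move: (q * _)%N; clear; lia.
have := centred_gaps_le d'_lt c_le hg hM.
under eq_bigr do rewrite gap'; move=> h.
apply: (@leq_trans (p * (k * ((d M + k) %/ q)))).
  rewrite leq_mul2l; apply/orP; right; apply: leq_trans h.
  by apply: leq_sum => i _; apply: leq_sub2l.
have le := leq_trunc_div (d M + k) q; move: le; set w := (_ %/ _)%N => le.
have -> : (p * (k * w) = 2 * (w * q))%N.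
  by rewrite {1}ks /q expnS mulnCA -!mulnA; congr (2 * _)%N; rewrite mulnA [LHS]mulnC (mulnC p).
by rewrite leq_mul2l le orbT.
Qed.

End Degrees.

Section Ratios.
Variables (R : realType) (k : nat) (X : nat -> lser 'F_p) (A : nat -> {poly 'F_p}).
Variables (N l : nat).
Hypotheses (chainX : cf_chain (phi (scaled k)) X) (AE : forall i, A i = lpolypart (X i)).
Hypothesis perA : periodic_from A N l.
Local Notation d := (cf_deg X).

Lemma period_degree_gt0 : (0 < \sum_(N <= i < N + l) pdeg (A i))%N.
Proof.
have [l0 per] := perA; rewrite big_ltn; last by rewrite -{1}[N]addn0 ltn_add2l.
rewrite ltn_addr // -per // -(prednK l0) addnS AE.
exact: cf_pdeg_gt0 chainX _.
Qed.

Lemma cf_deg_sub i : (d i.+1 - d i = pdeg (A i.+1))%N.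
Proof. by rewrite cf_degS addKn AE. Qed.

Lemma cf_deg_sum M : d M = (\sum_(i < M) pdeg (A i.+1))%N.
Proof. by apply: eq_bigr => i _; rewrite AE. Qed.

Lemma period_ratio_ge n (c C : R) :
  (forall T, exists2 M, (T <= M)%N &
     c * (d M)%:R - C <= (\sum_(i < M) (d i.+1 - d i - n))%:R) ->
  c <= period_ratio A N l n.
Proof.
move=> h; have [l0 per] := perA.
rewrite /period_ratio ler_pdivlMr ?ltr0n ?period_degree_gt0 //.
rewrite -subr_ge0 !natr_sum mulr_sumr -sumrB.
(* The extra constant pays for [A 0], which [cf_deg] leaves out. *)
apply: (@periodic_sum_ge0 _ _ N l (C - ((pdeg (A 0) - n)%:R - c * (pdeg (A 0))%:R))) => //.
  by move=> i leNi; rewrite per.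
move=> T; have [M leTM hM] := h T; exists M.+1; first exact: leqW.
rewrite big_ord_recl /= opprB lerD2l.
rewrite sumrB -mulr_sumr -!natr_sum -cf_deg_sum.
under eq_bigr do rewrite /bump /= add1n -cf_deg_sub.
by rewrite lerBrDl; move: hM; rewrite lerBlDr.
Qed.

Lemma period_ratio_le n (c C : R) :
  (forall M, (\sum_(i < M) (d i.+1 - d i - n))%:R <= c * (d M)%:R + C) ->
  period_ratio A N l n <= c.
Proof.
move=> h; have [l0 per] := perA.
rewrite /period_ratio ler_pdivrMr ?ltr0n ?period_degree_gt0 //.
rewrite -subr_ge0 !natr_sum mulr_sumr -sumrB.
apply: (@periodic_sum_ge0 _ _ N l (C - (c * (pdeg (A 0))%:R - (pdeg (A 0) - n)%:R))) => //.
  by move=> i leNi; rewrite per.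
move=> T; exists T.+1; first exact: leqnSn.
rewrite big_ord_recl /= opprB lerD2l.
rewrite sumrB -mulr_sumr -!natr_sum -cf_deg_sum.
under [X in _ <= _ - X%:R]eq_bigr do rewrite /bump /= add1n -cf_deg_sub.
by rewrite lerBrDl lerBlDr; exact: h.
Qed.

End Ratios.

End Expansions.

(** * Escape of mass *)

Section Escape.
Variables (R : realType) (p : nat).
Hypotheses (hp : prime p) (hodd : odd p).

Local Notation D := ('X^2 + 1 : {poly 'F_p}).
Local Notation scaled k := (lmul (Theta_p p) (lser_of_poly ('X ^+ k))).
Local Notation escape k n := (@Rkn 'F_p R (Theta_p p) 'X k n).

Let p_gt0 : (0 < p)%N := prime_gt0 hp.
Let p_gt1 : (1 < p)%N := prime_gt1 hp.
Let pR_gt0 : 0 < p%:R :> R. Proof. by rewrite ltr0n. Qed.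

(** Period data exist, so [xget] returns the ratio of an actual period and not its default 0. *)
Lemma Rkn_data k n : (0 < k)%N -> exists A N l,
  cf_period_data (scaled k) A N l /\ escape k n = period_ratio A N l n.
Proof.
move=> k0; rewrite /Rkn /escape_ratio.
set P := (X in xget 0 X); have : P (xget 0 P).
  apply: xgetPex; have [A [N [l h]]] := period_data_exists hp hodd k0.
  by exists (period_ratio A N l n), A, N, l.
by [].
Qed.

Lemma Rkn_ge k n : (1 < k)%N -> 2 / p%:R - (n.+1 * p)%:R / k%:R <= escape k n.
Proof.
move=> k1; have k0 : (0 < k)%N by apply: ltnW.
have [A [N [l [[expA [perA _]] ->]]]] := Rkn_data n k0.
have [X chainX AE] := chain_of_expansion expA.
pose s := trunc_log p k.-1; set q := (p ^ s)%N.
have hs : (p ^ s < k <= p ^ s.+1)%N.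
  have k1' : (0 < k.-1)%N by rewrite -ltnS prednK.
  have := trunc_logP p_gt1 k1'; have := trunc_log_ltn k.-1 p_gt1.
  by rewrite -/s; lia.
have qR0 : 0 < q%:R :> R by rewrite ltr0n expn_gt0 p_gt0.
have kR0 : 0 < k%:R :> R by rewrite ltr0n.
(* A block of length p q loses p (n + 1), a relative error (n + 1) / q; since k <= p q, this is at
   most (n + 1) p / k. *)
apply: (@le_trans _ _ (2 / p%:R - n.+1%:R / q%:R)).
  rewrite lerD2l lerN2 ler_pdivrMr // mulrAC ler_pdivlMr // -!natrM ler_nat -mulnA.
  by rewrite leq_mul2l /=; move: hs => /andP[_]; rewrite expnS.
set c := 2 / p%:R - _.
apply: (period_ratio_ge chainX AE perA (C := `|c|)) => T.
pose T' := (k.+1 * T + k)%N; have T'0 : (0 < T')%N by rewrite addn_gt0 k0 orbT.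
have [M [h1 h2 h3]] := gap_sum_ge hp hodd k0 chainX n hs T'0.
exists M; first by move: h3; rewrite leq_add2r leq_pmul2l.
(* The upper bound on d M can be multiplied by c only when c >= 0; for negative c the left side is
   already nonpositive. *)
have [c0|c0] := lerP 0 c; last first.
  apply: le_trans (ler0n _ _); rewrite subr_le0 (le_trans _ (normr_ge0 _)) //.
  by rewrite mulr_le0_ge0 // ltW.
rewrite -(ler_nat R) natrD in h1; rewrite -(ler_nat R) natrD in h2.
apply: (@le_trans _ _ (c * ((p ^ s * (p * T'))%:R + 1) - c)).
  by rewrite ger0_norm // lerD2r ler_wpM2l.
have -> : c * ((p ^ s * (p * T'))%:R + 1) - c = (2 * p ^ s * T')%:R - (p * n.+1 * T')%:R.
  rewrite /c -/q !natrM; field.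
  by rewrite !lt0r_neq0.
by rewrite lerBlDr.
Qed.

Lemma Rkn_le s n : (0 < n)%N -> escape (2 * p ^ s)%N n <= 2 / p%:R.
Proof.
move=> n0; set k := (2 * p ^ s)%N.
have k0 : (0 < k)%N by rewrite muln_gt0 expn_gt0 p_gt0.
have [A [N [l [[expA [perA _]] ->]]]] := Rkn_data n k0.
have [X chainX AE] := chain_of_expansion expA.
apply: (period_ratio_le chainX AE perA (C := 2 / p%:R * k%:R)) => M.
have := gap_sum_le hp hodd k0 chainX M (erefl k) n0.
rewrite -(ler_nat R) (natrM _ p) (natrM _ 2) natrD => h.
by rewrite -mulrDr mulrAC ler_pdivlMr // [leLHS]mulrC.
Qed.

(** Every tail contains some 2 p^m, which bounds its infimum above; the error term in [Rkn_ge] tends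
    to 0, which bounds it below. *)
Lemma limn_einf_Rkn n : (0 < n)%N ->
  limn_einf (fun k => (escape k n)%:E) = (2 / p%:R)%:E.
Proof.
move=> n0; rewrite limn_einf_lim; set u := fun k : nat => _.
have -> : limn (einfs u) = ereal_sup (range (einfs u)).
  by apply: cvg_lim => //; exact: cvg_einfs_sup.
apply/eqP; rewrite eq_le; apply/andP; split.
  apply: ge_ereal_sup => _ [m _ <-].
  apply: (@le_trans _ _ (escape (2 * p ^ m)%N n)%:E); last by rewrite lee_fin Rkn_le.
  apply: ereal_inf_lbound; exists (2 * p ^ m)%N => //=.
  by rewrite mul2n -addnn (leq_trans (ltnW (ltn_expl m p_gt1))) // leq_addr.
apply/lee_addgt0Pr => e e0.
(* For k >= m the error (n + 1) p / k is at most e; the second successor also ensures k > 1. *)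
pose m := (Num.truncn ((n.+1 * p)%:R / e : R)).+2.
apply: (@le_trans _ _ (einfs u m + e%:E)%E); last first.
  by rewrite leeD2r //; apply: ereal_sup_ubound; exists m.
rewrite -leeBlDr //; apply: le_ereal_inf_tmp => _ [k /= lemk <-].
have k1 : (1 < k)%N by apply: leq_trans lemk.
rewrite -EFinB lee_fin; apply: le_trans (Rkn_ge n k1).
rewrite lerD2l lerN2 ler_pdivrMr ?ltr0n 1?ltnW // mulrC -ler_pdivrMr //.
apply: (@le_trans _ _ (m.-1)%:R).
  by apply: ltW; apply: truncnS_gt.
by rewrite ler_nat (leq_trans _ lemk).
Qed.

Lemma Theta_quadratic : quadratic_irrational (Theta_p p).
Proof.
have two_neq0 := two_neq0_Fp hp hodd; have ThS := phi_Theta_sqr hp hodd.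
split.
  move=> q r q0 /lser_eqP; rewrite phi_mul !phi_poly => e.
  have : q ^+ 2 = D * r ^+ 2.
    apply: (@embed_inj 'F_p); rewrite mulrC rmorphXn rmorphM rmorphXn /= -e exprMn.
    by rewrite -mulrA ThS mulr1.
  move=> e2; have r0 := D_nonsquare two_neq0 e2.
  by move/eqP: e2; rewrite r0 expr0n mulr0 expf_eq0 (negPf q0).
exists D, 0, (- 1); split; first by rewrite D_neq0.
apply/lser_eqP; rewrite !phi_add !phi_mul !phi_poly phi_zero rmorph0 mul0r add0r.
by rewrite rmorphN rmorph1 -expr2 mulrC ThS subrr.
Qed.

Lemma limn_limn_einf_Rkn :
  limn (fun n => limn_einf (fun k => (escape k n)%:E)) = (2 / p%:R)%:E.
Proof.
(* At n = 0 nothing is truncated and the ratio is 1, so the sequence is constant only from n = 1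
   on. *)
apply: lim_near_cst => //; exists 1%N => // n /= n0.
exact: limn_einf_Rkn.
Qed.

End Escape.

Theorem theorem1p18 (R : realType) (p : nat) (hp : prime p) (hodd : odd p) :
  exact_escape_of_mass (Theta_p p) 'X (2 / p%:R : R).
Proof.
have p0 : 0 < p%:R :> R by rewrite ltr0n prime_gt0.
split=> [|c [_ _ _ _]]; last by rewrite limn_limn_einf_Rkn // lee_fin.
split.
- exact: Theta_quadratic.
- by rewrite -['X]subr0 -polyC0; apply: irredp_XsubC.
- by rewrite divr_gt0.
- by rewrite ler_pdivrMr // mul1r ler_nat prime_gt1.
by rewrite limn_limn_einf_Rkn.
Qed.
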